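(* Let $\zeta^{in}\in L^1_{0,1}(\mathbb{R}_{>0})$ with $\zeta^{in}\ge0$ a.e., let $\mathcal{S}\in L^1_{0,1}(\mathbb{R}_{>0})$ with $\mathcal{S}\ge0$, and let $\mathcal{R}:\mathbb{R}_{>0}\to[0,\infty)$ be measurable with $\mathcal{R}(p)\le k(1+p)^\alpha$ for all $p\in\mathbb{R}_{>0}$, where $k\ge0$ and $\alpha\in[0,1)$. Let $\mathcal{A}:\mathbb{R}_{>0}\times\mathbb{R}_{>0}\to[0,\infty)$ be measurable and symmetric and suppose that, for some constant $A\ge0$, $$\mathcal{A}(p,q)\le A(1+p)^{1/2}(1+q)^{1/2}\quad\text{for all }(p,q)\in\mathbb{R}_{>0}\times\mathbb{R}_{>0}.$$ Let $\zeta$ be a weak solution to the coagulation equation with kernel $\mathcal{A}$, source $\mathcal{S}$, removal coefficient $\mathcal{R}$ and initial value $\zeta^{in}$. Then $\zeta$ is the unique weak solution of this problem.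
   Context: $\mathbb{R}_{>0}=(0,\infty)$. $L^1_{0,1}(\mathbb{R}_{>0})$ denotes $L^1(\mathbb{R}_{>0};(1+p)\,dp)$. The coagulation equation with source and sedimentation is $$\partial_t\zeta(t,p)=\frac12\int_0^p\mathcal{A}(p-q,q)\zeta(t,p-q)\zeta(t,q)\,dq-\int_0^\infty\mathcal{A}(p,q)\zeta(t,p)\zeta(t,q)\,dq+\mathcal{S}(p)-\mathcal{R}(p)\zeta(t,p),\qquad \zeta(0,p)=\zeta^{in}(p).$$ A weak solution is a non-negative function $\zeta\in\mathcal{C}([0,\infty)_w;L^1(\mathbb{R}_{>0}))\cap L^\infty((0,T);L^1_{0,1}(\mathbb{R}_{>0}))$ for each $T>0$, such that $$\int_0^\infty[\zeta(t,p)-\zeta^{in}(p)]\,\omega(p)\,dp=\frac12\int_0^t\int_0^\infty\int_0^\infty\tilde\omega(p,q)\,\mathcal{A}(p,q)\,\zeta(s,p)\,\zeta(s,q)\,dq\,dp\,ds+\int_0^t\int_0^\infty\omega(p)\,[\mathcal{S}(p)-\mathcal{R}(p)\zeta(s,p)]\,dp\,ds$$ for every $T>0$, $t\in[0,T]$ and $\omega\in L^\infty(\mathbb{R}_{>0})$, where $\tilde\omega(p,q):=\omega(p+q)-\omega(p)-\omega(q)$. Here $\mathcal{C}([0,\infty)_w;L^1(\mathbb{R}_{>0}))$ is the space of functions $g$ from $[0,\infty)$ to $L^1(\mathbb{R}_{>0})$ such that $t\mapsto\int_0^\infty\omega(p)g(t,p)\,dp$ is continuous for all $\omega\in L^\infty(\mathbb{R}_{>0})$.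 *)

(* Defs.v *)
From HB Require Import structures.
From mathcomp Require Import all_boot all_order all_algebra.
From mathcomp Require Export all_classical all_reals all_analysis.
Set Implicit Arguments.
Unset Strict Implicit.
Unset Printing Implicit Defensive.
Import Order.TTheory GRing.Theory Num.Theory.
Import numFieldNormedType.Exports.

Local Open Scope classical_set_scope.
Local Open Scope ring_scope.

Definition Rpos (R : realType) : set R := [set p | 0 < p].
Arguments Rpos : clear implicits.

(* Elements of L^1, L^1_{0,1} and L^oo over (0, +oo) are given by real-valued
   representatives defined on all of R; their values outside (0, +oo) are
   irrelevant, and equality in these spaces is equality a.e. on (0, +oo). *)

Definition in_L1 (R : realType) (f : R -> R) : Prop :=
  (@lebesgue_measure R).-integrable (Rpos R) (EFin \o f).

Definition in_L1_01 (R : realType) (f : R -> R) : Prop :=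
  (@lebesgue_measure R).-integrable (Rpos R) (fun p => ((1 + p) * f p)%:E).

Definition in_Linfty (R : realType) (w : R -> R) : Prop :=
  measurable_fun (Rpos R) w /\
  exists M : R, {ae @lebesgue_measure R, forall p, Rpos R p -> `|w p| <= M}.

Definition ae_ge0 (R : realType) (f : R -> R) : Prop :=
  {ae @lebesgue_measure R, forall p, Rpos R p -> 0 <= f p}.

Definition in_C_weak_L1 (R : realType) (g : R -> R -> R) : Prop :=
  (forall t : R, 0 <= t -> in_L1 (g t)) /\
  forall w : R -> R, in_Linfty w ->
    {within `[0, +oo[, continuous
      (fun t => \int[@lebesgue_measure R]_(p in Rpos R) (w p * g t p))}.

Definition in_Linfty_L1_01 (R : realType) (T : R) (g : R -> R -> R) : Prop :=
  exists M : R, {ae @lebesgue_measure R, forall t, 0 < t < T ->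
    in_L1_01 (g t) /\
    (\int[@lebesgue_measure R]_(p in Rpos R) ((1 + p) * `|g t p|)%:E <= M%:E)%E}.

Definition omega_tilde (R : realType) (w : R -> R) (p q : R) : R :=
  w (p + q) - w p - w q.

(* The equation is stated in the extended reals so that no integral is
   truncated; for functions in the class of the first three clauses and the
   coefficients of the theorem, both sides are finite. *)
Definition weak_solution (R : realType) (A : R -> R -> R) (S Rm zin : R -> R)
    (zeta : R -> R -> R) : Prop :=
  let mu := @lebesgue_measure R in
  [/\ forall t : R, 0 <= t -> ae_ge0 (zeta t),
      in_C_weak_L1 zeta,
      forall T : R, 0 < T -> in_Linfty_L1_01 T zeta &
      forall T : R, 0 < T -> forall t : R, 0 <= t <= T ->
      forall w : R -> R, in_Linfty w ->
      (\int[mu]_(p in Rpos R) ((zeta t p - zin p) * w p)%:E =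
       (2^-1)%:E *
         (\int[mu]_(s in `[0%R, t]) \int[mu]_(p in Rpos R)
            \int[mu]_(q in Rpos R)
              (omega_tilde w p q * A p q * zeta s p * zeta s q)%:E) +
       \int[mu]_(s in `[0%R, t]) \int[mu]_(p in Rpos R)
          (w p * (S p - Rm p * zeta s p))%:E)%E].

(* Main.v *)
From HB Require Import structures.
Require Import Defs.
From mathcomp Require Import all_boot all_order all_algebra.
From mathcomp Require Import all_classical all_reals all_analysis.
From mathcomp Require Import measurable_realfun ring lra.
Import Order.TTheory GRing.Theory Num.Theory.
Import numFieldNormedType.Exports.
Set Implicit Arguments.
Unset Strict Implicit.
Unset Printing Implicit Defensive.
Local Open Scope classical_set_scope.
Local Open Scope ring_scope.

(** Uniqueness comes from a Gronwall estimate for the difference u of two weak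
    solutions f and g in the norm with weight (1+p)^(1/2). Write
    f(p)f(q) - g(p)g(q) = f(p)u(q) + u(p)g(q) and test formally with
    w = (1+p)^(1/2) sgn u. The square root is subadditive, so
    [w(p+q) - w(p) - w(q)] u(q) <= 2 (1+p)^(1/2) |u(q)|: the dangerous term
    (1+q)^(1/2) |u(q)| cancels. The kernel bound then turns the coagulation term
    into the product of a first moment, which is bounded, and of the weighted
    norm of u; removal only helps (lemma [rate_diff_sg]).

    This test function is neither bounded nor constant in time, while weak
    solutions are only tested with bounded functions of p. The weight is
    truncated at height c; a truncated subadditive nonnegative function is still
    subadditive, so the bound survives with a right-hand side independent of c.
    The sign is taken at the right end of a short time interval. The error is
    controlled by the distance between u at two nearby times, weighted by a
    function of sublinear growth: this is where the bounds on the removal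
    coefficient (alpha < 1) and on the kernel (exponent 1/2) are used. In L^1 the
    curve u is Lipschitz, since testing with the sign of an increment bounds its
    norm; first moments are bounded, and interpolation gives smallness. Summing
    over a fine partition yields, if u vanishes at time a and the weighted norm
    is at most B on [a, b], the bound C B (b - a) at time b. On intervals of
    length at most 1/(2C) the norm can be halved indefinitely, hence is zero, and
    finitely many such intervals cover [0, t] ([uniqueness_of_mean_value]).

    That argument sees the equation only through a mean value inequality: the
    increment of the pairing of u with w is at most (t - s) times an upper bound
    of the difference of rates on [s, t]. Deriving it from the integrated equation
    requires the rates to be measurable in time, although the map
    (t, p) -> zeta(t, p) need not be jointly measurable. By weak continuity the
    mass that zeta(t) gives to each Borel set is continuous in t, so that the
    densities form a measurable kernel, and integrals against a kernel depend
    measurably on the parameter ([measurable_Rintegral2_density]). The moment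
    bound, which is only assumed at almost every time, holds at every time by
    weak continuity ([clean_admissible]), so no exceptional set of times, on
    which the iterated integrals could fail to be finite, has to be removed. *)

(** * Integrals over the line, the plane and the half-line *)

Section Integrals.
Context {R : realType}.
Notation mu := (@lebesgue_measure R).

Definition integrableT (f : R -> R) := mu.-integrable setT (EFin \o f).

Lemma integrableT_meas (f : R -> R) : integrableT f -> measurable_fun setT f.
Proof. by move=> /integrableP[/measurable_EFinP]. Qed.

Lemma integrableT_le (f g : R -> R) : measurable_fun setT f -> integrableT g ->
  (forall x, `|f x| <= g x) -> integrableT f.
Proof.
move=> mf ig fg; apply: le_integrable ig => //; first exact/measurable_EFinP.
by move=> x _ /=; rewrite lee_fin (le_trans (fg x))// ler_norm.
Qed.

Lemma integrableTD (f g : R -> R) : integrableT f -> integrableT g ->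
  integrableT (fun x => f x + g x).
Proof. by move=> fi gi; exact: (integrableD _ fi gi). Qed.

Lemma integrableTB (f g : R -> R) : integrableT f -> integrableT g ->
  integrableT (fun x => f x - g x).
Proof. by move=> fi gi; exact: (integrableB _ fi gi). Qed.

Lemma integrableTZ (c : R) (f : R -> R) : integrableT f ->
  integrableT (fun x => c * f x).
Proof. by move=> fi; exact: (integrableZl _ c fi). Qed.

Lemma integrableT_norm (f : R -> R) : integrableT f ->
  integrableT (fun x => `|f x|).
Proof. by move=> fi; exact: (integrable_norm fi). Qed.

Lemma integrableT_normM (h f : R -> R) : (forall x, 0 <= h x) ->
  integrableT (fun x => h x * f x) -> integrableT (fun x => h x * `|f x|).
Proof.
move=> h0 /integrableT_norm; congr integrableT; apply/funext => x.
by rewrite normrM (ger0_norm (h0 _)).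
Qed.

Notation mu2 := (product_measure1 mu mu).

Definition integrableT2 (F : R * R -> R) := mu2.-integrable setT (EFin \o F).

Lemma integrableT2_le (f g : R * R -> R) : measurable_fun setT f -> integrableT2 g ->
  (forall x, `|f x| <= g x) -> integrableT2 f.
Proof.
move=> mf ig fg; apply: le_integrable ig => //; first exact/measurable_EFinP.
by move=> x _ /=; rewrite lee_fin (le_trans (fg x))// ler_norm.
Qed.

Lemma measurable_tensor (a b : R -> R) : measurable_fun setT a ->
  measurable_fun setT b -> measurable_fun setT (fun z : R * R => a z.1 * b z.2).
Proof.
by move=> ma mb; apply: measurable_funM; apply: measurableT_comp.
Qed.

Lemma integrableT2_tensor (a b : R -> R) : integrableT a -> integrableT b ->
  integrableT2 (fun z => a z.1 * b z.2).
Proof.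
move=> ia ib; have [ma mb] := (integrableT_meas ia, integrableT_meas ib).
have mab := measurable_tensor ma mb.
apply/integrableP; split; first exact/measurable_EFinP.
have mnab : measurable_fun setT (fun z : R * R => `|(a z.1 * b z.2)%:E|%E).
  by apply: measurableT_comp => //; exact/measurable_EFinP.
have tonelli : (\int[mu2]_z `|(a z.1 * b z.2)%:E| =
    \int[mu]_x \int[mu]_y `|(a x * b y)%:E|)%E.
  by apply: (@fubini_tonelli1 _ _ _ _ R mu mu
    (fun z : R * R => `|(a z.1 * b z.2)%:E|%E)).
suff: (\int[mu]_x \int[mu]_y `|(a x * b y)%:E| < +oo)%E by rewrite -tonelli.
have -> : (fun x => \int[mu]_y `|(a x * b y)%:E|)%E =
    (fun x => `|a x|%:E * \int[mu]_y `|(b y)%:E|)%E.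
  apply/funext => x; rewrite -ge0_integralZl//.
  - by apply: eq_integral => y _; rewrite /= normrM EFinM.
  - by apply: measurableT_comp => //; exact/measurable_EFinP.
have /integrableP[_ lb] := ib; have /integrableP[_ la] := ia.
rewrite ge0_integralZr//.
- apply: lte_mul_pinfty => //.
  + by apply: integral_ge0.
  + by rewrite ge0_fin_numE//; apply: integral_ge0.
- by apply/measurable_EFinP; exact: measurableT_comp.
- exact: integral_ge0.
Qed.

Lemma Rintegral2_tensor (a b : R -> R) : integrableT a -> integrableT b ->
  \int[mu2]_z (a z.1 * b z.2) = (\int[mu]_x a x) * (\int[mu]_x b x).
Proof.
move=> ia ib; rewrite {1}/Rintegral -integral12_prod_meas1; last first.
  exact: integrableT2_tensor.
rewrite /fubini_F /=.
under eq_integral => x _.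
  under eq_integral do rewrite EFinM.
  rewrite integralZl//.
  over.
rewrite /= -(fineK (integrable_fin_num _ ib))//.
by rewrite integralZr// fineM//; exact: integrable_fin_num.
Qed.

Lemma EFin_Rintegral (f : R -> R) : integrableT f ->
  ((\int[mu]_p f p)%:E = \int[mu]_p (f p)%:E)%E.
Proof. by move=> fi; rewrite /Rintegral fineK//; exact: integrable_fin_num. Qed.

End Integrals.

Section Half_line.
Context {R : realType}.
Notation mu := (@lebesgue_measure R).

Lemma ae_imp (P Q : R -> Prop) : (forall p, P p -> Q p) ->
  {ae mu, forall p, P p} ->
  {ae mu, forall p, Q p}.
Proof.
move=> PQ [N [mN N0 PN]]; exists N; split=> //.
by apply: subset_trans PN => x /= nQ /PQ.
Qed.

Lemma ae_and (P Q : R -> Prop) :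
  {ae mu, forall p, P p} ->
  {ae mu, forall p, Q p} ->
  {ae mu, forall p, P p /\ Q p}.
Proof.
move=> hP hQ; apply: negligibleS (negligibleU hP hQ) => p /=.
by move/not_andP.
Qed.

Lemma measurable_Rpos : measurable (Rpos R).
Proof.
rewrite (_ : Rpos R = `]0, +oo[%classic) //.
by apply/seteqP; split=> x /=; rewrite in_itv/= andbT.
Qed.

Lemma integrableT_restrict (f : R -> R) :
  mu.-integrable (Rpos R) (EFin \o f) <->
  integrableT (f \_ (Rpos R)).
Proof.
rewrite /integrableT -restrict_EFin; apply: integrable_mkcond.
exact: measurable_Rpos.
Qed.

(** Weak solutions are given by representatives that matter almost everywhere on
    the half-line; everything below is done with functions defined and measurable
    on the whole line and vanishing off the half-line. This is the bridge. *)
Lemma integral_Rpos_ext (f g : R -> R) :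
  measurable_fun (Rpos R) f -> integrableT g ->
  (forall p, ~ Rpos R p -> g p = 0) ->
  {ae mu, forall p, Rpos R p -> f p = g p} ->
  (\int[mu]_(p in Rpos R) (f p)%:E = (\int[mu]_p g p)%:E)%E.
Proof.
move=> mf gi gout fg; have mR := measurable_Rpos.
rewrite /Rintegral fineK; last exact: integrable_fin_num.
transitivity (\int[mu]_(p in Rpos R) (g p)%:E)%E.
  apply: ae_eq_integral => //; first exact/measurable_EFinP.
    by apply: measurable_funTS; exact: measurable_int gi.
  by apply: ae_imp fg => p /= E p0; rewrite E.
rewrite [LHS]integral_mkcond; apply: eq_integral => p _; rewrite patchE.
case: ifPn => // np; rewrite gout// => p0.
by rewrite mem_set in np.
Qed.

End Half_line.

(** * The weights 1 + |p| and its square root *)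

Section Weights.
Context {R : realType}.
Implicit Types p q : R.

Definition wt p : R := 1 + `|p|.
Definition sw p : R := Num.sqrt (wt p).

Lemma wt_ge1 p : 1 <= wt p. Proof. by rewrite /wt lerDl. Qed.

Lemma wt_ge0 p : 0 <= wt p. Proof. exact: le_trans ler01 (wt_ge1 p). Qed.

Lemma sw_ge1 p : 1 <= sw p.
Proof. by rewrite /sw -[leLHS]sqrtr1 ler_sqrt ?wt_ge1// wt_ge0. Qed.

Lemma sw_ge0 p : 0 <= sw p. Proof. exact: sqrtr_ge0. Qed.

Lemma sw_sqr p : sw p * sw p = wt p.
Proof. by rewrite -expr2 sqr_sqrtr// wt_ge0. Qed.

Lemma sw_le_wt p : sw p <= wt p.
Proof. by rewrite -sw_sqr ler_peMr ?sw_ge0 ?sw_ge1. Qed.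

Lemma swD p q : sw (p + q) <= sw p + sw q.
Proof.
rewrite -(@ler_pXn2r _ 2) ?nnegrE ?addr_ge0 ?sw_ge0// sqrrD.
rewrite !expr2 !sw_sqr (@le_trans _ _ (wt p + wt q))//.
  by rewrite /wt; have := ler_normD p q; lra.
have : 0 <= sw p * sw q by rewrite mulr_ge0 ?sw_ge0.
by lra.
Qed.

Lemma measurable_wt : measurable_fun setT (wt : R -> R).
Proof. by apply: measurable_funD => //; exact: measurableT_comp. Qed.

Lemma measurable_sw : measurable_fun setT (sw : R -> R).
Proof.
apply: measurableT_comp; last exact: measurable_wt.
exact: (continuous_measurable_fun (@sqrt_continuous R)).
Qed.

Definition trunc_sw (c : R) p : R := Num.min (sw p) c.

Lemma trunc_sw_le_sw c p : trunc_sw c p <= sw p. Proof. by rewrite ge_min lexx. Qed.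
Lemma trunc_sw_le c p : trunc_sw c p <= c. Proof. by rewrite ge_min lexx orbT. Qed.
Lemma trunc_sw_ge0 c p : 0 <= c -> 0 <= trunc_sw c p.
Proof. by move=> c0; rewrite le_min sw_ge0. Qed.

(** The minimum of a nonnegative subadditive function and of a nonnegative
    constant is again subadditive. *)
Lemma trunc_swD c p q : 0 <= c -> trunc_sw c (p + q) <= trunc_sw c p + trunc_sw c q.
Proof.
move=> c0; have := swD p q; have := sw_ge0 p; have := sw_ge0 q; rewrite /trunc_sw.
have [hp|hp] := leP (sw p) c; have [hq|hq] := leP (sw q) c => sq sp spq;
  by rewrite ge_min; apply/orP; (left; lra) || (right; lra).
Qed.

Lemma measurable_trunc_sw c : measurable_fun setT (trunc_sw c).
Proof. by apply: measurable_minr => //; exact: measurable_sw. Qed.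

(** Where the truncation is active, sw p > c, hence sw p <= sw p ^ 2 / c. The
    cost of truncating is therefore a first moment divided by c. *)
Lemma sw_le_trunc_sw c p : 0 < c -> sw p <= trunc_sw c p + wt p / c.
Proof.
move=> c0; rewrite /trunc_sw; have [swc|csw] := leP (sw p) c.
  by rewrite lerDl divr_ge0 ?wt_ge0// ltW.
rewrite (@le_trans _ _ (wt p / c))//; last by rewrite lerDr ltW.
by rewrite ler_pdivlMr// -sw_sqr ler_pM2l ?(ltW csw)// (lt_trans c0).
Qed.

(** Price for using the sign of v instead of that of u. *)
Lemma sgM_ge (v u : R) : `|u| - 2 * `|u - v| <= Num.sg v * u.
Proof.
have -> : Num.sg v * u = `|v| + Num.sg v * (u - v).
  by rewrite mulrBr -normrEsg addrC subrK.
have h1 : - `|u - v| <= Num.sg v * (u - v).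
  rewrite lerNl (le_trans (ler_norm _))// normrN normrM ler_piMl//.
  by rewrite normr_sg; case: (v != 0).
by have := ler_normD v (u - v); rewrite addrC subrK; lra.
Qed.

Lemma sgM_le (v u : R) : Num.sg v * u <= `|u|.
Proof.
rewrite (le_trans (ler_norm _))// normrM ler_piMl// normr_sg.
by case: (v != 0).
Qed.

Lemma measurable_sg (v : R -> R) : measurable_fun setT v ->
  measurable_fun setT (fun p => Num.sg (v p)).
Proof.
move=> mv.
rewrite (_ : (fun p => _) =
    (fun p => \1_(v @^-1` `]0, +oo[) p - \1_(v @^-1` `]-oo, 0[) p)).
  apply: measurable_funB; apply: measurable_indic;
  by rewrite -[_ @^-1` _]setTI; exact: mv.
apply/funext => p; rewrite !indicE.
have memE (i : interval R) : (p \in v @^-1` [set` i]) = (v p \in i).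
  by apply/idP/idP; rewrite inE.
rewrite !memE !in_itv/= andbT.
by case: sgrP => [||]; rewrite ?subr0 ?sub0r.
Qed.

(** For x at most L the first term alone suffices; L is chosen so that
    k x^al <= e x beyond it. *)
Lemma powR_sublinear (k al e : R) : 0 <= k -> 0 <= al < 1 -> 0 < e ->
  exists2 K, 0 <= K & forall x, 1 <= x -> k * x `^ al <= K + e * x.
Proof.
move=> k0 /andP[al0 al1] e0.
pose L := (k / e) `^ (1 - al)^-1.
exists (k * L `^ al); first by rewrite mulr_ge0 ?powR_ge0.
move=> x x1; have x0 : 0 < x by exact: lt_le_trans x1.
have be0 : 0 < 1 - al by rewrite subr_gt0.
have [xL|Lx] := leP x L.
  rewrite (@le_trans _ _ (k * L `^ al))// ?lerDl ?mulr_ge0 ?(ltW e0) ?(ltW x0)//.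
  by rewrite ler_wpM2l// ge0_ler_powR// ?nnegrE ?powR_ge0// ltW.
have h : k / e <= x `^ (1 - al).
  have -> : k / e = L `^ (1 - al).
    by rewrite -powRrM mulVf ?gt_eqF// powRr1// divr_ge0// ltW.
  by rewrite ge0_ler_powR// ?nnegrE ?powR_ge0 ?ltW.
rewrite (@le_trans _ _ (e * x))//; last by rewrite lerDr mulr_ge0 ?powR_ge0.
have -> : e * x = (e * x `^ (1 - al)) * x `^ al.
  by rewrite -mulrA -powRD ?subrK ?powRr1 ?(ltW x0)//; apply/implyP; rewrite gt_eqF.
by rewrite ler_wpM2r ?powR_ge0// mulrC -ler_pdivrMr.
Qed.

Notation mu := (@lebesgue_measure R).

Lemma integrableT_of_wt (f : R -> R) : measurable_fun setT f ->
  integrableT (fun p => wt p * f p) -> integrableT f.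
Proof.
move=> mf fi; apply: (integrableT_le mf (integrableT_norm fi)) => p.
by rewrite normrM ler_peMl// ger0_norm ?wt_ge0// wt_ge1.
Qed.

Lemma in_L1_of_01 (f : R -> R) : in_L1_01 f -> in_L1 f.
Proof.
move=> fi; have mR := @measurable_Rpos R.
have mf : measurable_fun (Rpos R) f.
  have m1 : measurable_fun (Rpos R) (fun p => (1 + p) * f p).
    by apply/measurable_EFinP; exact: (measurable_int _ fi).
  have m2 : measurable_fun (Rpos R) (fun p => wt p `^ (-1) * ((1 + p) * f p)).
    apply: measurable_funM => //; apply: measurable_funTS.
    exact: (measurableT_comp (measurable_powR (-1)) measurable_wt).
  apply: eq_measurable_fun m2 => p; rewrite inE => p0.
  have p0' : 0 < p by [].
  by rewrite powR_inv1 ?wt_ge0// /wt (gtr0_norm p0') mulKf// gt_eqF// addr_gt0.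
apply: le_integrable fi => //; first exact/measurable_EFinP.
move=> p p0; have p0' : 0 < p by [].
rewrite lee_fin normrM ler_peMl// ger0_norm ?lerDl ?ltW// addr_gt0//.
Qed.

End Weights.

(** * Coagulation and removal rates of a fixed density *)

Section Static.
Context {R : realType}.
Notation mu := (@lebesgue_measure R).
Notation mu2 := (product_measure1 mu mu).
Variables (A : R -> R -> R) (Rm : R -> R) (A0 : R).
Hypothesis mA : measurable_fun setT (fun z : R * R => A z.1 z.2).
Hypothesis A_ge0 : forall p q, 0 <= A p q.
Hypothesis A0_ge0 : 0 <= A0.
Hypothesis A_le : forall p q, A p q <= A0 * (sw p * sw q).
Hypothesis mRm : measurable_fun setT Rm.
Hypothesis Rm_ge0 : forall p, 0 <= Rm p.
Hypothesis Rm_sub : forall e, 0 < e -> exists2 K, 0 <= K &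
  forall p, Rm p <= K + e * wt p.

(** Asked at every point rather than almost everywhere, so that the pointwise
    inequalities below need no exceptional sets. *)
Definition admissible (M : R) (f : R -> R) := [/\ measurable_fun setT f,
  forall p, 0 <= f p, integrableT (fun p => wt p * f p) &
  \int[mu]_p (wt p * f p) <= M].

Definition bounded_meas (m : R) (w : R -> R) :=
  measurable_fun setT w /\ forall p, `|w p| <= m.

Definition coag_rate (w f : R -> R) : R := \int[mu2]_z
  (omega_tilde w z.1 z.2 * A z.1 z.2 * f z.1 * f z.2).

(** Time derivative of the integral of w against a solution equal to f, without
    the contribution of the source, which is the same for all solutions. *)
Definition net_rate (w f : R -> R) : R :=
  2^-1 * coag_rate w f - \int[mu]_p (w p * (Rm p * f p)).

Lemma bounded_meas_ge0 m w : bounded_meas m w -> 0 <= m.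
Proof. by move=> [_ /(_ 0)]; exact: le_trans. Qed.

Lemma omega_tilde_le m w p q : bounded_meas m w -> `|omega_tilde w p q| <= 3 * m.
Proof.
move=> [_ wm]; rewrite /omega_tilde.
have := ler_normB (w (p + q) - w p) (w q).
have := ler_normB (w (p + q)) (w p).
by have := wm (p + q); have := wm p; have := wm q; lra.
Qed.

Lemma measurable_omega_tilde w : measurable_fun setT w ->
  measurable_fun setT (fun z : R * R => omega_tilde w z.1 z.2).
Proof.
move=> mw; apply: measurable_funB; last exact: measurableT_comp.
apply: measurable_funB; last exact: measurableT_comp.
by apply: measurableT_comp => //; exact: measurable_funD.
Qed.

Lemma integrableT2_coag m w f g : bounded_meas m w ->
  measurable_fun setT f -> measurable_fun setT g ->
  integrableT (fun p => wt p * f p) -> integrableT (fun p => wt p * g p) ->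
  integrableT2 (fun z => omega_tilde w z.1 z.2 * A z.1 z.2 * f z.1 * g z.2).
Proof.
move=> bw mf mg fi gi; have m0 := bounded_meas_ge0 bw.
apply: (integrableT2_le _ (integrableT2_tensor
  (integrableTZ (3 * m * A0) (integrableT_norm fi)) (integrableT_norm gi))).
  apply: measurable_funM; last exact: measurableT_comp.
  apply: measurable_funM; last exact: measurableT_comp.
  by apply: measurable_funM => //; apply: measurable_omega_tilde; case: bw.
move=> [p q] /=; rewrite !normrM (ger0_norm (A_ge0 _ _)) !(ger0_norm (wt_ge0 _)).
have -> : 3 * m * A0 * (wt p * `|f p|) * (wt q * `|g q|) =
  (3 * m) * (A0 * (wt p * wt q)) * `|f p| * `|g q| by ring.
do 2 apply: ler_wpM2r => //.
apply: ler_pM => //; first exact: omega_tilde_le.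
apply: (le_trans (A_le _ _)); apply: ler_wpM2l => //.
by apply: ler_pM; rewrite ?sw_ge0 ?sw_le_wt.
Qed.

Lemma Rm_le_wt : exists2 k, 0 <= k & forall p, Rm p <= k * wt p.
Proof.
have [K K0 KR] := Rm_sub ltr01; exists (K + 1); first lra.
move=> p; apply: (le_trans (KR p)); rewrite mulrDl lerD2r.
by rewrite ler_peMr// wt_ge1.
Qed.

Lemma integrableT_dom (f h : R -> R) :
  measurable_fun setT f -> measurable_fun setT h ->
  (forall p, 0 <= h p) -> (exists2 k, 0 <= k & forall p, h p <= k * wt p) ->
  integrableT (fun p => wt p * f p) -> integrableT (fun p => h p * f p).
Proof.
move=> mf mh h0 [k k0 hk] fi.
apply: (integrableT_le _ (integrableTZ k (integrableT_norm fi))).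
  exact: measurable_funM.
move=> p; rewrite !normrM (ger0_norm (h0 _)) (ger0_norm (wt_ge0 _)) mulrA.
exact: ler_wpM2r.
Qed.

Lemma sw_dom : exists2 k : R, 0 <= k & forall p, sw p <= k * wt p.
Proof. by exists 1 => // p; rewrite mul1r sw_le_wt. Qed.

Lemma integrableT_bM m (w f : R -> R) : bounded_meas m w -> integrableT f ->
  integrableT (fun p => w p * f p).
Proof.
move=> [mw wm] fi; apply: (integrableT_le _ (integrableTZ m (integrableT_norm fi))).
  by apply: measurable_funM => //; exact: integrableT_meas.
by move=> p; rewrite normrM ler_wpM2r.
Qed.

Lemma integrableT_wtB M f g : admissible M f -> admissible M g ->
  integrableT (fun p => wt p * (f p - g p)).
Proof.
move=> [_ _ fi _] [_ _ gi _].
rewrite (_ : (fun p => _) = fun p => wt p * f p - wt p * g p).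
  exact: integrableTB.
by apply/funext => p; rewrite mulrBr.
Qed.

Lemma Rintegral_wtB M f g : admissible M f -> admissible M g ->
  \int[mu]_p (wt p * `|f p - g p|) <= 2 * M.
Proof.
move=> af ag; have := integrableT_norm (integrableT_wtB af ag).
move: af ag => [mf f0 fi fM] [mg g0 gi gM] i1.
apply: (@le_trans _ _ (\int[mu]_p (wt p * f p + wt p * g p))).
  apply: le_Rintegral => //; last 2 first.
  - exact: (integrableTD fi gi).
  - move=> p _; rewrite -mulrDr ler_wpM2l ?wt_ge0//.
    by rewrite (le_trans (ler_normB _ _))// !ger0_norm.
  - move: i1; congr (_.-integrable _ _); apply/funext => p /=.
    by rewrite normrM (ger0_norm (wt_ge0 _)).
by rewrite RintegralD//; lra.
Qed.

(** With u = f - g one has f(p)f(q) - g(p)g(q) = f(p)u(q) + u(p)g(q). Both terms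
    are instances of the assumed inequality, whose right-hand side is a product of
    a function of p and a function of q, so the double integral factorizes. The
    variable a stands for the value of the kernel: this makes the assumption
    symmetric enough to serve for both terms. *)
Lemma coag_diff_le m w M c b f g :
  bounded_meas m w -> admissible M f -> admissible M g ->
  0 <= c -> integrableT b -> (forall q, 0 <= b q) ->
  (forall p q a, 0 <= a -> a <= A0 * (sw p * sw q) ->
     omega_tilde w p q * a * (f q - g q) <= c * wt p * b q) ->
  coag_rate w f - coag_rate w g <= 2 * c * M * \int[mu]_p b p.
Proof.
move=> bw af ag c0 bi b0 H.
have [[mf f0 fi fM] [mg g0 gi gM]] := (af, ag).
have i1 := integrableT2_coag bw mf mf fi fi.
have i2 := integrableT2_coag bw mg mg gi gi.
rewrite /coag_rate -RintegralB//.
have t1 := integrableT2_tensor fi bi.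
have t2 := integrableT2_tensor bi gi.
have ti : integrableT2
    (fun z => c * (wt z.1 * f z.1 * b z.2 + b z.1 * (wt z.2 * g z.2))).
  exact: (integrableZl _ c (integrableD _ t1 t2)).
apply: (@le_trans _ _ (\int[mu2]_z
    (c * (wt z.1 * f z.1 * b z.2 + b z.1 * (wt z.2 * g z.2))))).
  apply: le_Rintegral => //; first exact: (integrableB _ i1 i2).
  move=> [p q] _ /=.
  have h1 := H p q (A p q) (A_ge0 p q) (A_le p q).
  have A2 : A p q <= A0 * (sw q * sw p) by rewrite (mulrC (sw q)).
  have h2 := H q p (A p q) (A_ge0 p q) A2.
  have e2 : omega_tilde w q p = omega_tilde w p q.
    by rewrite /omega_tilde (addrC q) addrAC.
  rewrite e2 in h2.
  have h1' := ler_wpM2l (f0 p) h1.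
  have h2' := ler_wpM2l (g0 q) h2.
  by lra.
rewrite RintegralZl//; last exact: (integrableD _ t1 t2).
rewrite RintegralD// (Rintegral2_tensor fi bi) (Rintegral2_tensor bi gi).
have B0 : 0 <= \int[mu]_p b p by exact: Rintegral_ge0.
have h1 := ler_wpM2r B0 fM; have h2 := ler_wpM2l B0 gM.
have := ler_wpM2l c0 (lerD h1 h2).
by congr (_ <= _); ring.
Qed.

Lemma rate_diff m w M f g : bounded_meas m w -> admissible M f -> admissible M g ->
  net_rate w f - net_rate w g = 2^-1 * (coag_rate w f - coag_rate w g)
     - \int[mu]_p (w p * (Rm p * (f p - g p))).
Proof.
move=> bw [mf f0 fi fM] [mg g0 gi gM].
have If := integrableT_bM bw (integrableT_dom mf mRm Rm_ge0 Rm_le_wt fi).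
have Ig := integrableT_bM bw (integrableT_dom mg mRm Rm_ge0 Rm_le_wt gi).
have -> : \int[mu]_p (w p * (Rm p * (f p - g p))) =
   \int[mu]_p (w p * (Rm p * f p)) - \int[mu]_p (w p * (Rm p * g p)).
  rewrite -RintegralB//; congr Rintegral; apply/funext => p.
  by rewrite !mulrBr.
by rewrite /net_rate; ring.
Qed.

(** Used with w the sign of an increment in time, this makes the difference of
    two solutions Lipschitz in L^1. *)
Lemma rate_diff_bounded M : exists2 C, 0 <= C & forall w f g,
  bounded_meas 1 w -> admissible M f -> admissible M g ->
  net_rate w f - net_rate w g <= C.
Proof.
have [k k0 Rk] := Rm_le_wt.
exists (`|3 * A0 * M * (2 * M)| + k * (2 * `|M|)).
  by rewrite addr_ge0 ?mulr_ge0.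
move=> w f g bw af ag; rewrite (rate_diff bw af ag).
have uM := Rintegral_wtB af ag.
have ui := integrableT_wtB af ag.
have ui' := integrableT_normM wt_ge0 ui.
have [[mf f0 fi fM] [mg g0 gi gM]] := (af, ag).
have M0 : 0 <= M.
  by apply: le_trans fM; apply: Rintegral_ge0 => p _; rewrite mulr_ge0 ?wt_ge0.
have cd : coag_rate w f - coag_rate w g <=
    2 * (3 * A0) * M * \int[mu]_p (wt p * `|f p - g p|).
  apply: (coag_diff_le bw af ag) => //; first by rewrite mulr_ge0.
    by move=> q; rewrite mulr_ge0 ?wt_ge0.
  move=> p q a a0 aA; apply: (le_trans (ler_norm _)); rewrite !normrM.
  rewrite (ger0_norm a0).
  have -> : 3 * A0 * wt p * (wt q * `|f q - g q|) =
    3 * 1 * (A0 * (wt p * wt q)) * `|f q - g q| by ring.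
  apply: ler_wpM2r => //; apply: ler_pM => //; first exact: omega_tilde_le.
  apply: (le_trans aA); apply: ler_wpM2l => //.
  by apply: ler_pM; rewrite ?sw_ge0 ?sw_le_wt.
have mu0 : measurable_fun setT (fun p => f p - g p) by exact: measurable_funB.
have iR := integrableT_bM bw (integrableT_dom mu0 mRm Rm_ge0 Rm_le_wt ui).
have rd : - (\int[mu]_p (w p * (Rm p * (f p - g p)))) <=
    k * \int[mu]_p (wt p * `|f p - g p|).
  apply: (le_trans (ler_norm _)); rewrite normrN.
  apply: (le_trans (le_normr_Rintegral _ iR)) => //.
  rewrite -RintegralZl//; apply: le_Rintegral => //.
  - exact: integrableT_norm.
  - exact: integrableTZ.
  - move=> p _; rewrite !normrM mulrA mulrA; apply: ler_wpM2r => //.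
    rewrite (ger0_norm (Rm_ge0 _)) -[leRHS]mul1r ler_pM//.
    by case: bw.
rewrite (ger0_norm M0) ger0_norm; last first.
  by do ![apply: mulr_ge0 => //].
move: cd rd uM; set N := \int[mu]_p (wt p * `|f p - g p|).
set D := \int[mu]_p _ => cd rd uM.
have h1 : 2 * (3 * A0) * M * N <= 2 * (3 * A0) * M * (2 * M).
  by apply: ler_wpM2l => //; do ![apply: mulr_ge0 => //].
have h2 : k * N <= k * (2 * M) by exact: ler_wpM2l.
clear - cd rd h1 h2; lra.
Qed.

(** If v = f - g the second integral vanishes and the
    rate of change of the truncated weighted norm of f - g is at most a multiple
    of its weighted norm. The factor in front of the first integral does not
    involve the truncation height c, so that c can be sent to infinity; the
    second integral accounts for a sign taken at another time. *)
Lemma rate_diff_sg c M f g v : 0 <= c -> admissible M f -> admissible M g ->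
  measurable_fun setT v -> integrableT (fun p => wt p * v p) ->
  net_rate (fun p => trunc_sw c p * Num.sg (v p)) f -
  net_rate (fun p => trunc_sw c p * Num.sg (v p)) g <=
    2 * A0 * M * \int[mu]_p (sw p * `|f p - g p|)
    + (2 * A0 * M * c + 2 * c) *
      \int[mu]_p ((sw p + Rm p) * `|f p - g p - v p|).
Proof.
move=> c0 af ag mv vi; set w := fun p => trunc_sw c p * Num.sg (v p).
have bw : bounded_meas c w.
  split.
    by apply: measurable_funM; [exact: measurable_trunc_sw|exact: measurable_sg].
  move=> p; rewrite normrM (ger0_norm (trunc_sw_ge0 _ c0)) normr_sg.
  by case: (v p != 0); rewrite ?mulr1 ?mulr0// trunc_sw_le.
rewrite (rate_diff bw af ag).
have [[mf f0 fi fM] [mg g0 gi gM]] := (af, ag).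
have M0 : 0 <= M.
  by apply: le_trans fM; apply: Rintegral_ge0 => p _; rewrite mulr_ge0 ?wt_ge0.
have mu0 : measurable_fun setT (fun p => f p - g p) by exact: measurable_funB.
have ui := integrableT_wtB af ag.
have me : measurable_fun setT (fun p => f p - g p - v p) by exact: measurable_funB.
have ei : integrableT (fun p => wt p * (f p - g p - v p)).
  have := integrableTB ui vi; congr integrableT; apply/funext => p; ring.
have sui := integrableT_normM sw_ge0
  (integrableT_dom mu0 measurable_sw sw_ge0 sw_dom ui).
have sei := integrableT_normM sw_ge0
  (integrableT_dom me measurable_sw sw_ge0 sw_dom ei).
have rei := integrableT_normM Rm_ge0
  (integrableT_dom me mRm Rm_ge0 Rm_le_wt ei).
set N := \int[mu]_p (sw p * `|f p - g p|).
have cd : coag_rate w f - coag_rate w g <= 2 * (2 * A0) * M *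
    \int[mu]_p (sw p * `|f p - g p| + c * (sw p * `|f p - g p - v p|)).
  apply: (coag_diff_le bw af ag) => //.
  - by rewrite mulr_ge0.
  - exact: (integrableTD sui (integrableTZ c sei)).
  - by move=> q; rewrite addr_ge0 ?mulr_ge0 ?sw_ge0.
  - move=> p q a a0 aA.
    set u := f q - g q; set e := `|f q - g q - v q|.
    have e0 : 0 <= e by exact: normr_ge0.
    have u0 : 0 <= `|u| by exact: normr_ge0.
    have tp := trunc_sw_ge0 p c0; have tq := trunc_sw_ge0 q c0.
    (* The term in w q is the only one with a favourable sign: it cancels the
       part trunc_sw(q) |u| produced by subadditivity. *)
    have h1 : w (p + q) * u <= (trunc_sw c p + trunc_sw c q) * `|u|.
      rewrite /w -mulrA (@le_trans _ _ (trunc_sw c (p + q) * `|u|))//.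
        by rewrite ler_wpM2l ?trunc_sw_ge0// sgM_le.
      by rewrite ler_wpM2r// trunc_swD.
    have h2 : - w p * u <= trunc_sw c p * `|u|.
      rewrite /w -mulrN -mulrA ler_wpM2l// -sgrN.
      exact: sgM_le.
    have h3 : - w q * u <= trunc_sw c q * (2 * e - `|u|).
      rewrite /w mulNr -mulrN -mulrA ler_wpM2l//.
      by have := sgM_ge (v q) u; rewrite -/e mulrN; lra.
    have hS : omega_tilde w p q * u <= 2 * sw p * `|u| + 2 * c * e.
      have h4 := ler_wpM2r u0 (trunc_sw_le_sw c p).
      have h5 := ler_wpM2r e0 (trunc_sw_le c q).
      by rewrite /omega_tilde; lra.
    have sp := sw_ge0 p; have sq := sw_ge0 q.
    have S0 : 0 <= 2 * sw p * `|u| + 2 * c * e.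
      by rewrite addr_ge0 ?mulr_ge0.
    rewrite mulrAC -/u.
    rewrite (le_trans (ler_wpM2r a0 hS))// (le_trans (ler_wpM2l S0 aA))//.
    have -> : (2 * sw p * `|u| + 2 * c * e) * (A0 * (sw p * sw q)) =
      2 * A0 * ((sw p * sw p) * (sw q * `|u|) + sw p * (c * (sw q * e))) by ring.
    rewrite sw_sqr -!mulrA !(ler_wpM2l _ _)// mulrDr lerD2l.
    by rewrite ler_wpM2r ?mulr_ge0// sw_le_wt.
have rd : - (\int[mu]_p (w p * (Rm p * (f p - g p)))) <=
    2 * c * \int[mu]_p (Rm p * `|f p - g p - v p|).
  have iwr := integrableT_bM bw (integrableT_dom mu0 mRm Rm_ge0 Rm_le_wt ui).
  rewrite -mulN1r -RintegralZl// -[leRHS]RintegralZl//.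
  apply: le_Rintegral => //; [exact: integrableTZ|exact: integrableTZ|].
  move=> p _; rewrite /w mulN1r.
  have tp := trunc_sw_ge0 p c0.
  have := sgM_ge (v p) (f p - g p); set u := f p - g p.
  set e := `|u - v p| => h.
  have h1 : - (Num.sg (v p) * u) <= 2 * e by have := normr_ge0 u; lra.
  have h2 : trunc_sw c p * - (Num.sg (v p) * u) <= c * (2 * e).
    rewrite (le_trans (ler_wpM2l tp h1))// ler_wpM2r ?trunc_sw_le//.
    by rewrite mulr_ge0 ?normr_ge0.
  by have := ler_wpM2l (Rm_ge0 p) h2; lra.
move: cd; rewrite RintegralD//; last exact: integrableTZ.
rewrite RintegralZl//.
have -> : \int[mu]_p ((sw p + Rm p) * `|f p - g p - v p|) =
   \int[mu]_p (sw p * `|f p - g p - v p|) +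
   \int[mu]_p (Rm p * `|f p - g p - v p|).
  rewrite -RintegralD//; congr Rintegral; apply/funext => p.
  by rewrite mulrDl.
rewrite -/N; move: rd.
set E1 := \int[mu]_p (sw p * `|f p - g p - v p|).
set E2 := \int[mu]_p (Rm p * `|f p - g p - v p|) => rd cd.
have E10 : 0 <= E1 by apply: Rintegral_ge0 => p _; rewrite mulr_ge0 ?sw_ge0.
have E20 : 0 <= E2 by apply: Rintegral_ge0 => p _; rewrite mulr_ge0.
have h1 : 0 <= c * E1 by rewrite mulr_ge0.
have h2 : 0 <= A0 * M * c * E2 by rewrite !mulr_ge0.
by lra.
Qed.

Lemma coag_bounded m M : exists C, forall w f, bounded_meas m w -> admissible M f ->
  `|coag_rate w f| <= C.
Proof.
exists (`|3 * m * A0 * M * M|) => w f bw [mf f0 fi fM].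
have m0 := bounded_meas_ge0 bw.
have i1 := integrableT2_coag bw mf mf fi fi.
rewrite (le_trans (le_normr_Rintegral _ i1))// (le_trans _ (ler_norm _))//.
apply: (@le_trans _ _
  (\int[mu2]_z (3 * m * A0 * (wt z.1 * f z.1 * (wt z.2 * f z.2))))).
  apply: le_Rintegral => //.
  - exact: integrable_norm i1.
  - exact: (integrableZl _ _ (integrableT2_tensor fi fi)).
  move=> [p q] _ /=; rewrite !normrM (ger0_norm (A_ge0 _ _)).
  rewrite (ger0_norm (f0 p)) (ger0_norm (f0 q)).
  have -> : 3 * m * A0 * (wt p * f p * (wt q * f q)) =
    (3 * m) * (A0 * (wt p * wt q)) * f p * f q by ring.
  do 2 apply: ler_wpM2r => //.
  apply: ler_pM => //; first exact: omega_tilde_le.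
  apply: (le_trans (A_le _ _)); apply: ler_wpM2l => //.
  by apply: ler_pM; rewrite ?sw_ge0 ?sw_le_wt.
rewrite RintegralZl//; last exact: (integrableT2_tensor fi fi).
rewrite (Rintegral2_tensor fi fi) -(mulrA _ M M).
have I0 : 0 <= \int[mu]_p (wt p * f p).
  by apply: Rintegral_ge0 => p _; rewrite mulr_ge0 ?wt_ge0.
by apply: ler_wpM2l; [rewrite !mulr_ge0|exact: ler_pM].
Qed.

Lemma removal_bounded m M : exists C, forall w f,
  bounded_meas m w -> admissible M f ->
  `|\int[mu]_p (w p * (Rm p * f p))| <= C.
Proof.
have [k k0 Rk] := Rm_le_wt.
exists (`|m * k * M|) => w f bw [mf f0 fi fM].
have m0 := bounded_meas_ge0 bw.
have i1 := integrableT_bM bw (integrableT_dom mf mRm Rm_ge0 Rm_le_wt fi).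
rewrite (le_trans (le_normr_Rintegral _ i1))// (le_trans _ (ler_norm _))//.
apply: (@le_trans _ _ (\int[mu]_p (m * k * (wt p * f p)))).
  apply: le_Rintegral => //; [exact: integrableT_norm|exact: integrableTZ|].
  move=> p _; rewrite !normrM (ger0_norm (f0 p)) (ger0_norm (Rm_ge0 p)).
  rewrite !mulrA ler_wpM2r// -mulrA ler_pM//; first by case: bw.
rewrite RintegralZl// ler_wpM2l// mulr_ge0//.
Qed.

End Static.

(** * Uniqueness from a mean value inequality *)

Lemma increment_le (R : realType) (f : R -> R) (a b K d : R) : 0 < d -> a <= b ->
  (forall s t, a <= s -> s <= t -> t <= b -> t - s <= d ->
     f t - f s <= K * (t - s)) ->
  f b - f a <= K * (b - a).
Proof.
move=> d0 ab H.
have step n : forall t, a <= t -> t <= b -> t - a <= n.+1%:R * d ->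
    f t - f a <= K * (t - a).
  elim: n => [|n IH] t at_ tb tn.
    by apply: H => //; rewrite mul1r in tn.
  have [/IH|nt] := leP (t - a) (n.+1%:R * d); first exact.
  have n1 : 1 <= n.+1%:R :> R by rewrite ler1n.
  have nd : d <= n.+1%:R * d by rewrite ler_peMl// ltW.
  have h1 : f (t - d) - f a <= K * (t - d - a).
    apply: IH; [lra|lra|].
    by move: tn; rewrite -natr1 mulrDl mul1r; lra.
  have h2 : f t - f (t - d) <= K * (t - (t - d)) by apply: H; lra.
  lra.
apply: (step (Num.truncn ((b - a) / d))) => //.
by rewrite -ler_pdivrMr// ltW// truncnS_gt.
Qed.

Section Uniq.
Context {R : realType}.
Notation mu := (@lebesgue_measure R).
Variables (A : R -> R -> R) (Rm : R -> R) (A0 : R).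
Hypothesis mA : measurable_fun setT (fun z : R * R => A z.1 z.2).
Hypothesis A_ge0 : forall p q, 0 <= A p q.
Hypothesis A0_ge0 : 0 <= A0.
Hypothesis A_le : forall p q, A p q <= A0 * (sw p * sw q).
Hypothesis mRm : measurable_fun setT Rm.
Hypothesis Rm_ge0 : forall p, 0 <= Rm p.
Hypothesis Rm_sub : forall e, 0 < e -> exists2 K, 0 <= K &
  forall p, Rm p <= K + e * wt p.

Variables (T M : R) (X Z : R -> R -> R).
Hypothesis admX : forall r, 0 <= r < T -> admissible M (X r).
Hypothesis admZ : forall r, 0 <= r < T -> admissible M (Z r).
Hypothesis mean_value : forall m w s t K,
  bounded_meas m w -> 0 <= s -> s <= t -> t < T ->
  (forall r, s <= r <= t -> net_rate A Rm w (X r) - net_rate A Rm w (Z r) <= K) ->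
  \int[mu]_p (w p * (X t p - Z t p)) - \int[mu]_p (w p * (X s p - Z s p))
    <= K * (t - s).
Hypothesis u0 : \int[mu]_p `|X 0 p - Z 0 p| = 0.

Let u t p := X t p - Z t p.

Let u_meas t : 0 <= t < T -> measurable_fun setT (u t).
Proof.
by move=> tT; have [[mX _ _ _] [mZ _ _ _]] := (admX tT, admZ tT);
  exact: measurable_funB.
Qed.

Let wui t : 0 <= t < T -> integrableT (fun p => wt p * u t p).
Proof. by move=> tT; exact: integrableT_wtB (admX tT) (admZ tT). Qed.

Let ui t : 0 <= t < T -> integrableT (u t).
Proof. by move=> tT; exact: integrableT_of_wt (u_meas tT) (wui tT). Qed.

Let M_ge0 t : 0 <= t < T -> 0 <= M.
Proof.
move=> /admX[_ X0 _]; apply: le_trans; apply: Rintegral_ge0 => p _.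
by rewrite mulr_ge0 ?wt_ge0.
Qed.

(** Test with the sign of the increment u t - u s itself. *)
Let lip : exists2 C, 0 <= C & forall s t, 0 <= s -> s <= t -> t < T ->
  \int[mu]_p `|u t p - u s p| <= C * (t - s).
Proof.
have [C C0 HC] := rate_diff_bounded mA A_ge0 A0_ge0 A_le mRm Rm_ge0 Rm_sub M.
exists C => // s t s0 st tT.
have sT : 0 <= s < T by rewrite s0 (le_lt_trans st).
have tT' : 0 <= t < T by rewrite (le_trans s0).
pose w p := Num.sg (u t p - u s p).
have bw : bounded_meas 1 w.
  split; first by apply: measurable_sg; apply: measurable_funB; exact: u_meas.
  by move=> p; rewrite normr_sg; case: (_ != 0); rewrite /= ?ler01.
have -> : \int[mu]_p `|u t p - u s p| =
    \int[mu]_p (w p * u t p) - \int[mu]_p (w p * u s p).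
  rewrite -RintegralB//; last 2 first.
  - exact: (integrableT_bM bw (ui tT')).
  - exact: (integrableT_bM bw (ui sT)).
  congr Rintegral; apply/funext => p; rewrite -mulrBr /w.
  by rewrite -normrEsg.
apply: (mean_value bw s0 st tT) => r /andP[sr rt]; apply: HC => //.
  by apply: admX; rewrite (le_trans s0)//= (le_lt_trans rt).
by apply: admZ; rewrite (le_trans s0)//= (le_lt_trans rt).
Qed.

(** The weight sw + Rm is at most K' + 2 eta wt with eta arbitrarily small: the
    first part is handled by the Lipschitz bound in L^1, the second one by the
    bound 4 M on the first moment of the increment. *)
Let equicont e : 0 < e -> exists2 d, 0 < d &
  forall r t, 0 <= r -> r <= t -> t < T -> t - r <= d ->
  \int[mu]_p ((sw p + Rm p) * `|u r p - u t p|) <= e.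
Proof.
move=> e0; have [C C0 HC] := lip.
have m0 : 0 < 1 + `|M| by rewrite ltr_wpDr.
pose eta := e / (16 * (1 + `|M|)).
have eta0 : 0 < eta by rewrite divr_gt0// mulr_gt0.
have [K K0 HK] := Rm_sub eta0.
pose K' := eta^-1 + K.
have K'0 : 0 < K' by rewrite ltr_wpDr// invr_gt0.
exists (e / (2 * (K' * C + 1))).
  by rewrite divr_gt0// mulr_gt0// ltr_wpDl// mulr_ge0// ltW.
move=> r t r0 rt tT tr.
have rT : 0 <= r < T by rewrite r0 (le_lt_trans rt).
have tT' : 0 <= t < T by rewrite (le_trans r0).
have mdiff : measurable_fun setT (fun p => u r p - u t p).
  by apply: measurable_funB; exact: u_meas.
have di : integrableT (fun p => u r p - u t p) by apply: integrableTB; exact: ui.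
have wdi : integrableT (fun p => wt p * `|u r p - u t p|).
  apply: (integrableT_normM wt_ge0).
  have := integrableTB (wui rT) (wui tT').
  by congr integrableT; apply/funext => p; rewrite -mulrBr.
have nui s : 0 <= s < T -> integrableT (fun p => wt p * `|u s p|).
  by move=> sT; exact: integrableT_normM wt_ge0 (wui sT).
have ptw p : sw p + Rm p <= K' + 2 * eta * wt p.
  have c0 : 0 < eta^-1 by rewrite invr_gt0.
  have := sw_le_trunc_sw p c0; rewrite invrK; have := trunc_sw_le eta^-1 p.
  have := HK p; rewrite /K'; lra.
have bound : \int[mu]_p ((sw p + Rm p) * `|u r p - u t p|) <=
    K' * \int[mu]_p `|u t p - u r p| +
    2 * eta * \int[mu]_p (wt p * `|u r p - u t p|).
  rewrite -!RintegralZl//; last first.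
    by apply: integrableT_norm; exact: (integrableTB (ui tT') (ui rT)).
  have di' : integrableT (fun p => K' * `|u t p - u r p|).
    apply: integrableTZ; apply: integrableT_norm.
    exact: (integrableTB (ui tT') (ui rT)).
  rewrite -RintegralD//; last exact: integrableTZ.
  have big := integrableTD di' (integrableTZ (2 * eta) wdi).
  have pt p : (sw p + Rm p) * `|u r p - u t p| <=
      K' * `|u t p - u r p| + 2 * eta * (wt p * `|u r p - u t p|).
    by have := ler_wpM2r (normr_ge0 (u r p - u t p)) (ptw p);
      rewrite (distrC (u t p)); lra.
  apply: le_Rintegral => //.
  apply: (integrableT_le _ big) => [|p].
    apply: measurable_funM; last exact: measurableT_comp.
    by apply: measurable_funD => //; exact: measurable_sw.
  by rewrite ger0_norm// mulr_ge0// addr_ge0// sw_ge0.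
have wbound : \int[mu]_p (wt p * `|u r p - u t p|) <= 4 * M.
  apply: (@le_trans _ _ (\int[mu]_p (wt p * `|u r p| + wt p * `|u t p|))).
    apply: le_Rintegral => //; first exact: integrableTD (nui _ rT) (nui _ tT').
    by move=> p _; rewrite -mulrDr ler_wpM2l ?wt_ge0// ler_normB.
  rewrite RintegralD//; try exact: nui.
  have := Rintegral_wtB (admX rT) (admZ rT).
  have := Rintegral_wtB (admX tT') (admZ tT').
  by rewrite /u => h1 h2; lra.
apply: (le_trans bound).
have h1 : K' * \int[mu]_p `|u t p - u r p| <= e / 2.
  have h : C * (t - r) <= C * (e / (2 * (K' * C + 1))) by exact: ler_wpM2l.
  have h' := ler_wpM2l (ltW K'0) (le_trans (HC r t r0 rt tT) h).
  apply: (le_trans h').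
  have kc : 0 < K' * C + 1 by rewrite ltr_wpDl// mulr_ge0// ltW.
  rewrite (_ : K' * (C * (e / (2 * (K' * C + 1)))) =
    (e / 2) * ((K' * C) / (K' * C + 1))); last first.
    by field; rewrite gt_eqF.
  rewrite ler_piMr//; first by rewrite ltW// divr_gt0.
  by rewrite ler_pdivrMr// mul1r lerDl.
have h2 : 2 * eta * \int[mu]_p (wt p * `|u r p - u t p|) <= e / 2.
  have M0 := M_ge0 rT.
  have e20 : 0 <= 2 * eta by rewrite mulr_ge0// ltW.
  apply: (le_trans (ler_wpM2l e20 wbound)); rewrite /eta ger0_norm//.
  rewrite (_ : 2 * (e / (16 * (1 + M))) * (4 * M) = (e / 2) * (M / (1 + M))).
    rewrite ler_piMr//; first by rewrite ltW// divr_gt0.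
    by rewrite ler_pdivrMr ?mul1r ?lerDr// ltr_wpDr.
  by field; rewrite gt_eqF// ltr_wpDr.
lra.
Qed.

Let swui t : 0 <= t < T -> integrableT (fun p => sw p * `|u t p|).
Proof.
move=> tT; apply: (integrableT_normM sw_ge0).
exact: integrableT_dom (u_meas tT) measurable_sw sw_ge0 sw_dom (wui tT).
Qed.

(** One turn of the Gronwall argument. On each interval of a partition the test
    function is the truncated weight times the sign of u at the right end t: it
    reproduces the norm at t and is at most the norm at the left end s. *)
Let step a b B : 0 <= a -> a <= b -> b < T -> \int[mu]_p `|u a p| = 0 ->
  (forall r, a <= r <= b -> \int[mu]_p (sw p * `|u r p|) <= B) ->
  \int[mu]_p (sw p * `|u b p|) <= 2 * A0 * M * B * (b - a).
Proof.
move=> a0 ab bT ua NB.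
have aT : 0 <= a < T by rewrite a0 (le_lt_trans ab).
have bT' : 0 <= b < T by rewrite (le_trans a0).
have M0 := M_ge0 aT.
have ctr c t : 0 < c -> 0 <= t < T -> integrableT (fun p => trunc_sw c p * `|u t p|).
  move=> c0 tT; have bt : bounded_meas c (trunc_sw c).
    split; first exact: measurable_trunc_sw.
    by move=> p; rewrite ger0_norm ?trunc_sw_le// trunc_sw_ge0// ltW.
  exact: (integrableT_bM bt (integrableT_norm (ui tT))).
have trunc c : 0 < c ->
    \int[mu]_p (trunc_sw c p * `|u b p|) <= 2 * A0 * M * B * (b - a).
  move=> c0; apply/ler_addgt0Pr => e e0.
  pose kap := 2 * A0 * M * c + 2 * c.
  have kap0 : 0 < kap by rewrite ltr_wpDl ?mulr_ge0 ?mulr_gt0// ltW.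
  pose e' := e / (kap * (b - a + 1)).
  have ba1 : 0 < b - a + 1 by rewrite ltr_wpDl// subr_ge0.
  have e'0 : 0 < e' by rewrite divr_gt0// mulr_gt0.
  have [d d0 Hd] := equicont e'0.
  have inc : \int[mu]_p (trunc_sw c p * `|u b p|) - \int[mu]_p (trunc_sw c p * `|u a p|)
      <= (2 * A0 * M * B + kap * e') * (b - a).
    apply: (@increment_le _
      (fun t => \int[mu]_p (trunc_sw c p * `|u t p|)) _ _ _ d) => //.
    move=> s t as_ st tb ts.
    have s0 : 0 <= s := le_trans a0 as_.
    have tT : t < T := le_lt_trans tb bT.
    have tT' : 0 <= t < T by rewrite tT (le_trans s0).
    have sT : 0 <= s < T by rewrite s0 (le_lt_trans st).
    pose w p := trunc_sw c p * Num.sg (u t p).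
    have bw : bounded_meas c w.
      split.
        apply: measurable_funM; [exact: measurable_trunc_sw|].
        by apply: measurable_sg; exact: u_meas.
      move=> p; rewrite normrM (ger0_norm (trunc_sw_ge0 _ (ltW c0))) normr_sg.
      by case: (_ != 0); rewrite ?mulr1 ?mulr0 ?trunc_sw_le// ltW.
    have e1 : \int[mu]_p (trunc_sw c p * `|u t p|) = \int[mu]_p (w p * u t p).
      by congr Rintegral; apply/funext => p; rewrite /w -mulrA -normrEsg.
    have e2 : \int[mu]_p (w p * u s p) <= \int[mu]_p (trunc_sw c p * `|u s p|).
      apply: le_Rintegral => //.
      - exact: (integrableT_bM bw (ui sT)).
      - exact: ctr.
      - move=> p _; rewrite /w -mulrA ler_wpM2l ?sgM_le//.
        by rewrite trunc_sw_ge0// ltW.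
    have main : \int[mu]_p (w p * u t p) - \int[mu]_p (w p * u s p) <=
        (2 * A0 * M * B + kap * e') * (t - s).
      apply: (mean_value bw s0 st tT) => r /andP[sr rt].
      have r0 : 0 <= r := le_trans s0 sr.
      have rT : 0 <= r < T by rewrite r0 (le_lt_trans rt).
      apply: (le_trans (rate_diff_sg mA A_ge0 A0_ge0 A_le mRm Rm_ge0 Rm_sub
        (ltW c0) (admX rT) (admZ rT) (u_meas tT') (wui tT'))).
      have h1 : \int[mu]_p (sw p * `|X r p - Z r p|) <= B.
        by apply: NB; rewrite (le_trans as_ sr) (le_trans rt tb).
      have h2 : \int[mu]_p ((sw p + Rm p) * `|X r p - Z r p - u t p|) <= e'.
        by apply: Hd => //; lra.
      apply: lerD; apply: ler_wpM2l => //; first by rewrite !mulr_ge0.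
      exact: ltW.
    by rewrite e1; apply: le_trans main; rewrite lerD2l lerN2.
  have za : \int[mu]_p (trunc_sw c p * `|u a p|) <= 0.
    rewrite (_ : 0 = c * \int[mu]_p `|u a p|); last by rewrite ua mulr0.
    rewrite -RintegralZl//; last exact: (integrableT_norm (ui aT)).
    apply: le_Rintegral => //; first exact: ctr.
      exact: integrableTZ (integrableT_norm (ui aT)).
    by move=> p _; rewrite ler_wpM2r// trunc_sw_le.
  have small : kap * e' * (b - a) <= e.
    rewrite (_ : kap * e' * (b - a) = e * ((b - a) / (b - a + 1))).
      rewrite ler_piMr ?(ltW e0)// ler_pdivrMr// mul1r; lra.
    by rewrite /e'; field; rewrite !gt_eqF.
  lra.
(* Remove the truncation: its cost is at most 2 * M / c. *)
apply/ler_addgt0Pr => e e0.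
pose c := (2 * M + 1) / e.
have c0 : 0 < c by rewrite divr_gt0// ltr_wpDl// mulr_ge0.
have h1 := trunc c c0.
have wub := integrableT_normM wt_ge0 (wui bT').
have h2 : \int[mu]_p (sw p * `|u b p|) <=
    \int[mu]_p (trunc_sw c p * `|u b p|) + c^-1 * \int[mu]_p (wt p * `|u b p|).
  rewrite -RintegralZl// -RintegralD//; [|exact: ctr|exact: integrableTZ].
  apply: le_Rintegral => //; first exact: swui.
    exact: integrableTD (ctr _ _ c0 bT') (integrableTZ _ wub).
  by move=> p _; rewrite mulrA -mulrDl (mulrC c^-1) ler_wpM2r ?sw_le_trunc_sw.
have h3 := Rintegral_wtB (admX bT') (admZ bT').
have h4 : c^-1 * \int[mu]_p (wt p * `|u b p|) <= e.
  rewrite ler_pdivrMl//; apply: (le_trans h3).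
  have -> : c * e = 2 * M + 1 by rewrite /c divfK// gt_eqF.
  by rewrite lerDl.
exact: (le_trans h2 (lerD h1 h4)).
Qed.

(** The length tau is such that one step at least halves a bound; the initial
    bound 2 M comes from the first moments. *)
Let halve tau a : 0 <= a -> \int[mu]_p `|u a p| = 0 -> 2 * A0 * M * tau <= 2^-1 ->
  forall b, a <= b -> b - a <= tau -> b < T -> \int[mu]_p `|u b p| = 0.
Proof.
move=> a0 ua tau2 b ab bta bT.
have aT : 0 <= a < T by rewrite a0 (le_lt_trans ab).
have M0 := M_ge0 aT.
have rT r : a <= r -> r <= b -> 0 <= r < T.
  by move=> ar rb; rewrite (le_trans a0 ar) (le_lt_trans rb bT).
have dec n : forall r, a <= r <= b ->
    \int[mu]_p (sw p * `|u r p|) <= 2 * M / 2 ^+ n.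
  elim: n => [|n IH] r /andP[ar rb].
    rewrite expr0 divr1.
    have rT' := rT r ar rb.
    apply: (le_trans _ (Rintegral_wtB (admX rT') (admZ rT'))).
    apply: le_Rintegral => //; first exact: swui.
      exact: integrableT_normM wt_ge0 (wui rT').
    by move=> p _; rewrite ler_wpM2r// sw_le_wt.
  have rT' := rT r ar rb.
  have IH' : forall r', a <= r' <= r ->
      \int[mu]_p (sw p * `|u r' p|) <= 2 * M / 2 ^+ n.
    by move=> r' /andP[h1 h2]; apply: IH; rewrite h1 (le_trans h2).
  have /andP[_ rT2] := rT'.
  apply: (le_trans (step a0 ar rT2 ua IH')).
  have B0 : 0 <= 2 * M / 2 ^+ n by rewrite divr_ge0 ?exprn_ge0// mulr_ge0.
  have h1 : 2 * A0 * M * (r - a) <= 2^-1.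
    apply: le_trans tau2; apply: ler_wpM2l; first by rewrite !mulr_ge0.
    by lra.
  rewrite exprS invfM mulrCA; have := ler_wpM2r B0 h1; lra.
have N0 : \int[mu]_p (sw p * `|u b p|) <= 0.
  apply/ler_addgt0Pr => e e0; rewrite add0r.
  pose n := Num.truncn (2 * M / e).
  have bb : a <= b <= b by rewrite ab lexx.
  apply: (le_trans (dec n.+1 b bb)).
  rewrite ler_pdivrMr ?exprn_gt0// [e * _]mulrC -ler_pdivrMr//.
  apply: (le_trans (ltW (truncnS_gt _))); rewrite -/n.
  by rewrite -natrX ler_nat ltnW// ltn_expl.
have bT' : 0 <= b < T by rewrite (le_trans a0).
apply/eqP; rewrite eq_le; apply/andP; split; last exact: Rintegral_ge0.
apply: le_trans N0; apply: le_Rintegral => //.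
- exact: (integrableT_norm (ui bT')).
- exact: swui.
- by move=> p _; rewrite ler_peMl// sw_ge1.
Qed.

(** Propagation by intervals of the fixed length tau. *)
Lemma uniqueness_of_mean_value t : 0 <= t < T -> \int[mu]_p `|X t p - Z t p| = 0.
Proof.
move=> tT; have M0 := M_ge0 tT.
pose tau := 2^-1 / (2 * A0 * M + 1).
have k0 : 0 <= 2 * A0 * M by rewrite !mulr_ge0.
have k1 : 0 < 2 * A0 * M + 1 by rewrite ltr_wpDl.
have tau0 : 0 < tau by rewrite divr_gt0.
have tau2 : 2 * A0 * M * tau <= 2^-1.
  rewrite /tau mulrCA ler_piMr// ler_pdivrMr// mul1r; lra.
have ind n : forall t, 0 <= t -> t < T -> t <= n%:R * tau ->
    \int[mu]_p `|u t p| = 0.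
  elim: n => [|n IH] s s0 sT sn.
    by have -> : s = 0 by move: sn; rewrite mul0r; lra.
  have [/IH|ns] := leP s (n%:R * tau); first exact.
  have nt0 : 0 <= n%:R * tau by rewrite mulr_ge0// ltW.
  apply: (@halve tau (n%:R * tau)) => //.
  - by apply: IH => //; exact: lt_trans sT.
  - exact: ltW.
  - by move: sn; rewrite -natr1 mulrDl mul1r; lra.
have /andP[t0 tT'] := tT.
apply: (ind (Num.truncn (t / tau)).+1) => //.
by rewrite -ler_pdivrMr// ltW// truncnS_gt.
Qed.

End Uniq.

(** * Measurable dependence of integrals on a density *)

Section Density.
Context {R : realType}.
Notation mu := (@lebesgue_measure R).
Local Open Scope ereal_scope.

(** Bundled so that the measure with a given density is a finite measure by
    instance inference. *)
Record density := Density {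
  density_fun :> R -> R;
  density_ge0 : forall p, (0 <= density_fun p)%R;
  density_intg : integrableT density_fun }.

Definition density_measure (f : density) (V : set (measurableTypeR R)) : \bar R :=
  \int[mu]_(y in V) (f y)%:E.

Section density_measure.
Variable f : density.

Let density_measure0 : density_measure f set0 = 0. Proof. exact: integral_set0. Qed.

Let density_measure_ge0 V : 0 <= density_measure f V.
Proof. by apply: integral_ge0 => y _; rewrite lee_fin density_ge0. Qed.

Let density_measure_sigma_additive : semi_sigma_additive (density_measure f).
Proof.
move=> F mF tF mUF; rewrite /density_measure ge0_integral_bigcup//.
- apply: is_cvg_ereal_nneg_natsum_cond => n _ _; exact: density_measure_ge0.
- apply: measurable_funTS; apply/measurable_EFinP.
  exact: (integrableT_meas (density_intg f)).
- by move=> x _; rewrite lee_fin density_ge0.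
Qed.

HB.instance Definition _ := isMeasure.Build _ _ _ (density_measure f)
  density_measure0 density_measure_ge0 density_measure_sigma_additive.

Let density_measure_fin : fin_num_fun (density_measure f).
Proof.
move=> V mV; apply: integrable_fin_num => //.
apply: (integrableS _ _ _ (density_intg f)) => //.
Qed.

HB.instance Definition _ := Measure_isFinite.Build _ _ _
  (density_measure f) density_measure_fin.

(** The density of an absolutely continuous finite measure is almost everywhere
    unique, so the Radon-Nikodym derivative may be replaced by f. *)
Lemma integral_density_measure (g : R -> \bar R) : (forall y, 0 <= g y) ->
  measurable_fun setT g ->
  \int[density_measure f]_y g y = \int[mu]_y (g y * (f y)%:E).
Proof.
move=> g0 mg.
have dom : density_measure f `<< mu.
  apply/null_content_dominatesP => V mV V0.
  apply: null_set_integral => //.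
  apply: measurable_funTS; apply/measurable_EFinP.
  exact: (integrableT_meas (density_intg f)).
rewrite -(Radon_Nikodym_SigmaFinite.change_of_variables dom)//.
set h := Radon_Nikodym_SigmaFinite.f _ _.
have mh := measurable_int _ (Radon_Nikodym_SigmaFinite.f_integrable dom).
have mf : measurable_fun setT (fun y => (f y)%:E).
  by apply/measurable_EFinP; exact: (integrableT_meas (density_intg f)).
have hf : ae_eq mu setT h (fun y => (f y)%:E).
  apply: integral_ae_eq => //.
    exact: Radon_Nikodym_SigmaFinite.f_integrable.
  by move=> E _ mE; rewrite -(Radon_Nikodym_SigmaFinite.f_integral dom).
apply: ae_eq_integral => //; try exact: emeasurable_funM.
by apply: filterS hf => y /= hfy yT; rewrite hfy.
Qed.

End density_measure.

Section kernel.
Import HBNNSimple.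
Context d (X : measurableType d) (Z : X -> density).
Hypothesis mZ : forall E, measurable E ->
  measurable_fun setT (fun x => \int[mu]_(y in E) (Z x y)%:E).

Let K x : {measure set (measurableTypeR R) -> \bar R} := density_measure (Z x).

(** The measures with density Z x form a kernel, because their values on each
    Borel set are measurable in x; joint measurability of Z is not assumed. *)
Lemma measurable_fun_integral_density (k : X * R -> \bar R) :
  (forall z, 0 <= k z) -> measurable_fun setT k ->
  measurable_fun setT (fun x => \int[mu]_y (k (x, y) * (Z x y)%:E)).
Proof.
move=> k0 mk.
have -> : (fun x => \int[mu]_y (k (x, y) * (Z x y)%:E)) =
    (fun x => \int[K x]_y k (x, y)).
  apply/funext => x; rewrite integral_density_measure//.
  by apply: measurableT_comp => //.
pose H : isKernel _ _ X (measurableTypeR R) R K :=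
  isKernel.Build _ _ X (measurableTypeR R) R K mZ.
pose K' : R.-ker X ~> measurableTypeR R := HB.pack K H.
pose k' : X * measurableTypeR R -> \bar R := k.
have mk' : measurable_fun setT k' := mk.
pose k_ := nnsfun_approx measurableT mk'.
apply: (@measurable_fun_xsection_integral _ _ X (measurableTypeR R) R k' K k_).
- by move=> a b ab; exact/nd_nnsfun_approx.
- by move=> z; exact/cvg_nnsfun_approx.
- move=> n r.
have mA : measurable (k_ n @^-1` [set r]) by [].
have Kfin x : exists M, forall V, measurable V -> mrestr (K x) measurableT V < M%:E.
  exists (fine (K x setT) + 1)%R => V mV; rewrite /mrestr setIT.
  rewrite (@le_lt_trans _ _ (K x setT))//; first by rewrite le_measure ?inE.
  by rewrite EFinD fineK ?fin_num_measure// lteDl// ?fin_num_measure// lte_fin.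
have [_] := @measurable_prod_subset_xsection_kernel _ _ X (measurableTypeR R) R
  K' setT measurableT Kfin _ mA.
by congr measurable_fun; apply/funext => x; rewrite /mrestr setIT.
Qed.

End kernel.

Lemma maxe_mulr0 (a b : R) : (0 <= b)%R -> maxe (a * b)%:E 0 = (Num.max a 0 * b)%:E.
Proof.
by move=> b0; rewrite -EFin_max maxr_pMl// mul0r.
Qed.

Lemma measurable_Rintegral_density d (X : measurableType d) (Z : X -> density)
    (mZ : forall E, measurable E ->
      measurable_fun setT (fun x => \int[mu]_(y in E) (Z x y)%:E))
    (k : X * R -> R) : measurable_fun setT k ->
  measurable_fun setT (fun x => \int[mu]_p (k (x, p) * Z x p))%R.
Proof.
have pos (h : X * R -> R) : measurable_fun setT h ->
    measurable_fun setT (fun x => \int[mu]_p maxe (h (x, p) * Z x p)%:E 0).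
  move=> mh; pose h' z := (Num.max (h z) 0%R)%:E.
  have mh' : measurable_fun setT h'.
    by apply/measurable_EFinP; exact: measurable_maxr.
  have h'0 z : 0 <= h' z by rewrite lee_fin le_max lexx orbT.
  have := measurable_fun_integral_density mZ h'0 mh'.
  congr measurable_fun; apply/funext => x; apply: eq_integral => p _.
  by rewrite maxe_mulr0// density_ge0.
move=> mk; apply: measurableT_comp => //.
have -> : (fun x => \int[mu]_p (k (x, p) * Z x p)%:E) = (fun x =>
    \int[mu]_p maxe (k (x, p) * Z x p)%:E 0 -
    \int[mu]_p maxe (- k (x, p) * Z x p)%:E 0).
  apply/funext => x; rewrite integralE; congr (_ - _).
    by apply: eq_integral => p _; rewrite funeposE.
  by apply: eq_integral => p _; rewrite funenegE mulNr EFinN.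
apply: emeasurable_funB; first exact: pos.
by apply: (pos (fun z => - k z)%R); exact: measurable_funN.
Qed.

Section family.
Variable Z : R -> density.
Hypothesis mZ : forall E, measurable E ->
  measurable_fun setT (fun r => \int[mu]_(y in E) (Z r y)%:E).

(** Iterate the one-variable statement: the inner integral is measurable in the
    pair (r, z.1), the parameter of the kernel being r alone. *)
Lemma measurable_Rintegral2_density (H : R * R -> R) : measurable_fun setT H ->
  measurable_fun setT
    (fun r => \int[product_measure1 mu mu]_z (H z * Z r z.1 * Z r z.2))%R.
Proof.
have pos (h : R * R -> R) : measurable_fun setT h ->
    measurable_fun setT (fun r => \int[product_measure1 mu mu]_z
      maxe (h z * Z r z.1 * Z r z.2)%:E 0).
  move=> mh; pose h' z : R := Num.max (h z) 0%R.
  have mh' : measurable_fun setT h' by exact: measurable_maxr.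
  have h'0 z : (0 <= h' z)%R by rewrite le_max lexx orbT.
  pose G (x : R * R) := \int[mu]_q ((h' (x.2, q))%:E * (Z x.1 q)%:E).
  have mG : measurable_fun setT G.
    pose k (y : (R * R) * R) := (h' (y.1.2, y.2))%:E.
    have mk : measurable_fun setT k.
      apply/measurable_EFinP.
      have mt : measurable_fun setT (fun y : (R * R) * R => (y.1.2, y.2)).
        apply: measurable_fun_pair => //.
        exact: (measurableT_comp measurable_snd measurable_fst).
      exact: (measurableT_comp mh' mt).
    have k0 y : 0 <= k y by rewrite lee_fin.
    have mZ' E : measurable E ->
      measurable_fun setT (fun x : R * R => \int[mu]_(y in E) (Z x.1 y)%:E).
      move=> mE; exact: (measurableT_comp (mZ mE)).
    exact: (measurable_fun_integral_density mZ' k0 mk).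
  have G0 x : 0 <= G x.
    by apply: integral_ge0 => q _; rewrite -EFinM lee_fin mulr_ge0// density_ge0.
  have := measurable_fun_integral_density mZ G0 mG.
  congr measurable_fun; apply/funext => r.
  have mZr := integrableT_meas (density_intg (Z r)).
  have m1 : measurable_fun setT
      (fun z : R * R => (h' z * Z r z.1 * Z r z.2)%:E).
    apply/measurable_EFinP; apply: measurable_funM; last exact: measurableT_comp.
    by apply: measurable_funM => //; exact: measurableT_comp.
  transitivity (\int[product_measure1 mu mu]_z (h' z * Z r z.1 * Z r z.2)%:E).
    have F0 (z : R * R) : 0 <= (h' z * Z r z.1 * Z r z.2)%:E.
      by rewrite lee_fin !mulr_ge0// density_ge0.
    rewrite (@fubini_tonelli1 _ _ _ _ R mu mu
      (fun z : R * R => (h' z * Z r z.1 * Z r z.2)%:E) m1 F0).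
    apply: eq_integral => p _; rewrite /fubini_F /G /=.
    rewrite -ge0_integralZr//.
    - by apply: eq_integral => q _; rewrite -!EFinM; congr EFin; ring.
    - apply: emeasurable_funM; apply/measurable_EFinP => //.
      by apply: measurableT_comp => //.
    - by move=> q _; rewrite -EFinM lee_fin mulr_ge0// density_ge0.
    - by rewrite lee_fin density_ge0.
  apply: eq_integral => z _.
  by rewrite -[(h z * _ * _)%R]mulrA maxe_mulr0 ?mulr_ge0 ?density_ge0// mulrA.
move=> mH; apply: measurableT_comp => //.
have -> : (fun r => \int[product_measure1 mu mu]_z (H z * Z r z.1 * Z r z.2)%:E) =
    (fun r => \int[product_measure1 mu mu]_z maxe (H z * Z r z.1 * Z r z.2)%:E 0 -
      \int[product_measure1 mu mu]_z maxe (- H z * Z r z.1 * Z r z.2)%:E 0).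
  apply/funext => r; rewrite integralE; congr (_ - _).
    by apply: eq_integral => z _; rewrite funeposE.
  by apply: eq_integral => z _; rewrite funenegE !mulNr EFinN.
by apply: emeasurable_funB; apply: pos => //; exact: measurable_funN.
Qed.

End family.
End Density.

(** * Representatives on the whole line and first moments at every time *)

Section Clean.
Context {R : realType}.
Notation mu := (@lebesgue_measure R).
Variable zeta : R -> R -> R.
Hypothesis zeta_ge0 : forall t : R, 0 <= t -> ae_ge0 (zeta t).
Hypothesis zeta_cont : in_C_weak_L1 zeta.

(** A representative that is nonnegative everywhere and vanishes off the
    half-line. It is constant over negative times, so that continuity on [0, +oo[
    gives measurability on the whole time axis. *)
Definition clean (r : R) : R -> R :=
  (fun p => Num.max (zeta (Num.max r 0) p) 0) \_ (Rpos R).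

Lemma clean_ge0 r p : 0 <= clean r p.
Proof. by rewrite /clean patchE; case: ifP => // _; rewrite le_max lexx orbT. Qed.

Let max_ge0 r : 0 <= Num.max r 0 :> R.
Proof. by rewrite le_max lexx orbT. Qed.

Lemma clean_intg r : integrableT (clean r).
Proof.
have [L1 _] := zeta_cont; have zi := L1 _ (max_ge0 r).
have mR := @measurable_Rpos R.
suff h : mu.-integrable (Rpos R)
    (EFin \o (fun p => Num.max (zeta (Num.max r 0) p) 0)).
  exact/integrableT_restrict.
apply: le_integrable zi => //.
  apply/measurable_EFinP; apply: measurable_maxr => //.
  by apply/measurable_EFinP; exact: (measurable_int _ (L1 _ (max_ge0 r))).
move=> p _ /=; rewrite lee_fin.
by rewrite /Num.max; case: ifP => // _; rewrite normr0.
Qed.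

Definition clean_density r : density := Density (clean_ge0 r) (clean_intg r).

Lemma clean_ae r : 0 <= r -> {ae mu, forall p, Rpos R p -> zeta r p = clean r p}.
Proof.
move=> r0; have := zeta_ge0 r0; apply: ae_imp => p H p0.
by rewrite /clean patchE mem_set// (max_idPl r0) max_l// H.
Qed.

Lemma clean_out r p : ~ Rpos R p -> clean r p = 0.
Proof. by move=> np; rewrite /clean patchE memNset. Qed.

Lemma restrict_id (f : R -> R) : (forall p, ~ Rpos R p -> f p = 0) ->
  f \_ (Rpos R) = f.
Proof.
move=> H; apply/funext => p; rewrite patchE; case: ifPn => // np.
by rewrite H// => p0; rewrite mem_set in np.
Qed.

Lemma zeta_meas r : 0 <= r -> measurable_fun (Rpos R) (zeta r).
Proof.
move=> r0; have [L1 _] := zeta_cont.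
by apply/measurable_EFinP; exact: (measurable_int _ (L1 _ r0)).
Qed.

Lemma clean_meas r : measurable_fun setT (clean r).
Proof. exact: integrableT_meas (clean_intg r). Qed.

Lemma pairing_clean (w : R -> R) r : 0 <= r -> measurable_fun setT w ->
  \int[mu]_(p in Rpos R) (w p * zeta r p) = \int[mu]_p (w p * clean r p).
Proof.
move=> r0 mw; have mR := @measurable_Rpos R.
transitivity (\int[mu]_(p in Rpos R) (w p * clean r p)).
  congr fine; apply: ae_eq_integral => //.
  - apply/measurable_EFinP; apply: measurable_funM; last exact: zeta_meas.
    exact: measurable_funTS.
  - apply/measurable_EFinP; apply: measurable_funTS; apply: measurable_funM => //.
    exact: clean_meas.
  - by apply: ae_imp (clean_ae r0) => p /= H p0; rewrite H.
rewrite Rintegral_mkcond restrict_id// => p np.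
by rewrite clean_out ?mulr0.
Qed.

Lemma bounded_meas_Linfty m (w : R -> R) : bounded_meas m w -> in_Linfty w.
Proof.
move=> [mw wm]; split; first exact: measurable_funTS.
by exists m; apply: aeW => p _; exact: wm.
Qed.

Lemma clean_max r : clean (Num.max r 0) = clean r.
Proof. by rewrite /clean (max_idPl (max_ge0 r)). Qed.

Lemma clean_cont m w : bounded_meas m w ->
  {within `[0, +oo[, continuous (fun t => \int[mu]_p (w p * clean t p))}.
Proof.
move=> bw; have [_ /(_ w (bounded_meas_Linfty bw))] := zeta_cont.
apply: subspace_eq_continuous => t.
rewrite inE/= in_itv/= andbT => t0.
by apply: pairing_clean => //; case: bw.
Qed.

(** Pair with the indicator of E and use weak continuity. *)
Lemma clean_time_measurable E : measurable E ->
  measurable_fun setT (fun r => \int[mu]_(y in E) (clean_density r y)%:E)%E.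
Proof.
move=> mE.
have bw : bounded_meas 1 (\1_E : R -> R).
  split; first exact: measurable_indic.
  by move=> p; rewrite indicE; case: (p \in E); rewrite /= ?normr1 ?normr0.
have mg : measurable_fun (`[0, +oo[%classic : set R)
    (fun t => \int[mu]_p (\1_E p * clean t p)).
  by apply: subspace_continuous_measurable_fun => //; exact: clean_cont bw.
have mmax : measurable_fun setT (fun r : R => Num.max r 0).
  exact: measurable_maxr.
have mc : measurable_fun setT
    (fun r : R => \int[mu]_p (\1_E p * clean (Num.max r 0) p)).
  apply: (measurable_comp _ _ mg mmax) => //.
  by move=> _ [r _ <-] /=; rewrite in_itv/= andbT.
have /measurable_EFinP := mc; congr measurable_fun; apply/funext => r /=.
have iE := integrableT_bM bw (clean_intg r).
rewrite clean_max /Rintegral fineK; last exact: integrable_fin_num.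
rewrite [RHS]integral_mkcond; apply: eq_integral => p _.
rewrite patchE indicE; case: ifP => _ /=; first by rewrite mul1r.
by rewrite mul0r.
Qed.

Section moment.
Variables (T M : R).
Hypothesis bound : {ae mu, forall t, 0 < t < T -> in_L1_01 (zeta t) /\
  (\int[mu]_(p in Rpos R) ((1 + p) * `|zeta t p|)%:E <= M%:E)%E}.

Let tw (n : nat) (p : R) : R := Num.min (wt p) n%:R.

Let tw_bmeas n : bounded_meas n%:R (tw n).
Proof.
split; first by apply: measurable_minr => //; exact: measurable_wt.
by move=> p; rewrite ger0_norm ?le_min ?wt_ge0 ?ler0n// ge_min lexx orbT.
Qed.

Let tw_ae n : {ae mu, forall t, 0 < t < T ->
  \int[mu]_p (tw n p * clean t p) <= M}.
Proof.
apply: ae_imp bound => t H /andP[t0 tT].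
have [zi zM] := H (introT andP (conj t0 tT)).
have mR := @measurable_Rpos R.
have twi := integrableT_bM (tw_bmeas n) (clean_intg t).
rewrite -lee_fin /Rintegral fineK; last exact: integrable_fin_num.
apply: le_trans zM.
rewrite [X in (X <= _)%E](_ : _ =
    (\int[mu]_(p in Rpos R) (tw n p * clean t p)%:E)%E); last first.
  rewrite [RHS]integral_mkcond; apply: eq_integral => p _; rewrite patchE.
  case: ifPn => // np; rewrite clean_out ?mulr0// => p0.
  by rewrite mem_set in np.
rewrite [X in (X <= _)%E](_ : _ =
    (\int[mu]_(p in Rpos R) (tw n p * `|zeta t p|)%:E)%E); last first.
  apply: ae_eq_integral => //.
  - apply: measurable_funTS; exact: measurable_int twi.
  - apply/measurable_EFinP; apply: measurable_funM.
      by apply: measurable_funTS; case: (tw_bmeas n).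
    by apply: measurableT_comp => //; apply: zeta_meas; exact: ltW.
  - apply: ae_imp (clean_ae (ltW t0)) => p /= E p0.
    by rewrite E// ger0_norm// clean_ge0.
apply: ge0_le_integral => //.
- by move=> p _; rewrite lee_fin mulr_ge0// le_min wt_ge0 ler0n.
- apply/measurable_EFinP; apply: measurable_funM.
    by apply: measurable_funTS; case: (tw_bmeas n).
  by apply: measurableT_comp => //; apply: zeta_meas; exact: ltW.
- apply/measurable_EFinP; apply: measurable_funM.
    by apply: measurable_funTS; apply: measurable_funD.
  by apply: measurableT_comp => //; apply: zeta_meas; exact: ltW.
- move=> p p0; have p0' : 0 < p by [].
  rewrite lee_fin ler_wpM2r// /tw ge_min.
  by rewrite /wt (gtr0_norm p0') lexx.
Qed.

(** A continuous function bounded by M at almost every time is bounded by M at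
    every time: otherwise it would exceed M on an interval to the right of t. *)
Let tw_all n t : 0 <= t < T -> \int[mu]_p (tw n p * clean t p) <= M.
Proof.
move=> /andP[t0 tT]; rewrite leNgt; apply/negP => Mt.
have /subspace_continuousP/(_ t) := clean_cont (tw_bmeas n).
rewrite /= in_itv/= andbT => /(_ t0)/cvgr_gt/(_ _ Mt).
rewrite near_withinE => /nbhs_ballP[e /= e0 He].
pose b := Num.min (t + e) T.
have tb : t < b by rewrite lt_min ltrDl e0.
have bad : `]t, b[ `<=` [set s | ~ (0 < s < T ->
    \int[mu]_p (tw n p * clean s p) <= M)].
  move=> s /=; rewrite in_itv/= lt_min => /andP[ts /andP[se sT]] H.
  have s0 : 0 < s by exact: le_lt_trans ts.
  have : M < \int[mu]_p (tw n p * clean s p).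
    apply: He; rewrite ?in_itv/= ?andbT ?ltW//.
    by rewrite /ball/= ltr0_norm ?subr_lt0//; lra.
  by rewrite ltNge H// s0 sT.
have [N [mN N0 NH]] := tw_ae n.
have : (mu `]t, b[ <= mu N)%E.
  by apply: le_measure; rewrite ?inE//; exact: subset_trans NH.
rewrite N0 lebesgue_measure_itv/= lte_fin tb -EFinB lee_fin.
by rewrite subr_le0 leNgt tb.
Qed.

(** Monotone convergence along the truncated weights. *)
Lemma clean_admissible t : 0 <= t < T -> admissible M (clean t).
Proof.
move=> tT.
have mwc : measurable_fun setT (fun p => wt p * clean t p).
  by apply: measurable_funM; [exact: measurable_wt|exact: clean_meas].
have wc0 p : 0 <= wt p * clean t p by rewrite mulr_ge0 ?wt_ge0 ?clean_ge0.
have lim_tw p : ((tw n p * clean t p)%:E @[n --> \oo] --> (wt p * clean t p)%:E)%E.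
  apply: cvg_near_cst; near=> n.
  rewrite /tw min_l//; near: n; exact: nbhs_infty_ger.
have le_M : (\int[mu]_p (wt p * clean t p)%:E <= M%:E)%E.
  have -> : (\int[mu]_p (wt p * clean t p)%:E =
      \int[mu]_p limn (fun n => (tw n p * clean t p)%:E))%E.
    by apply: eq_integral => p _; apply/esym/cvg_lim => //; exact: lim_tw.
  have nd p : nondecreasing_seq (fun n => (tw n p * clean t p)%:E).
    move=> i j ij; rewrite lee_fin ler_wpM2r ?clean_ge0// /tw.
    by rewrite le_min !ge_min lexx ler_nat ij orbT.
  rewrite monotone_convergence//.
  - apply: lime_le; last first.
      apply: nearW => n; rewrite -(fineK (integrable_fin_num measurableT
        (integrableT_bM (tw_bmeas n) (clean_intg t)))) lee_fin.
      exact: tw_all.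
    apply: ereal_nondecreasing_is_cvgn => i j ij.
    apply: ge0_le_integral => //.
    + by move=> p _; rewrite lee_fin mulr_ge0 ?clean_ge0// le_min wt_ge0 ler0n.
    + exact: measurable_int (integrableT_bM (tw_bmeas i) (clean_intg t)).
    + exact: measurable_int (integrableT_bM (tw_bmeas j) (clean_intg t)).
    + by move=> p _; exact: nd.
  - by move=> n; exact: measurable_int (integrableT_bM (tw_bmeas n) (clean_intg t)).
  - by move=> n p _; rewrite lee_fin mulr_ge0 ?clean_ge0// le_min wt_ge0 ler0n.
have wi : integrableT (fun p => wt p * clean t p).
  apply/integrableP; split; first exact/measurable_EFinP.
  under eq_integral => p _ do rewrite /= ger0_norm//.
  exact: le_lt_trans le_M (ltry _).
split=> //; first exact: clean_meas.
  exact: clean_ge0.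
by rewrite -lee_fin /Rintegral fineK// integrable_fin_num.
Unshelve. all: by end_near.
Qed.

End moment.
End Clean.

(** * The weak equation as an identity between real integrals *)

Section Coefs.
Context {R : realType}.
Notation mu := (@lebesgue_measure R).
Implicit Types (A : R -> R -> R) (Rm : R -> R).

Definition extend2 A (p q : R) : R :=
  ((fun z : R * R => A z.1 z.2) \_ (Rpos R `*` Rpos R)) (p, q).

Lemma extend2E A p q : 0 < p -> 0 < q -> extend2 A p q = A p q.
Proof. by move=> p0 q0; rewrite /extend2 patchE mem_set. Qed.

Lemma extend2_out A p q : ~ (0 < p /\ 0 < q) -> extend2 A p q = 0.
Proof. by move=> npq; rewrite /extend2 patchE memNset. Qed.

Lemma extend2_meas A :
  measurable_fun (Rpos R `*` Rpos R) (fun pq : R * R => A pq.1 pq.2) ->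
  measurable_fun setT (fun z : R * R => extend2 A z.1 z.2).
Proof.
move=> mA; have mRR : measurable (Rpos R `*` Rpos R).
  by apply: measurableX; exact: measurable_Rpos.
have := (measurable_restrictT (fun z : R * R => A z.1 z.2) mRR).1 mA.
by congr measurable_fun; apply/funext => -[p q].
Qed.

Lemma extend2_ge0 A : (forall p q, 0 < p -> 0 < q -> 0 <= A p q) ->
  forall p q, 0 <= extend2 A p q.
Proof.
move=> A0 p q; have [[p0 q0]|npq] := pselect (0 < p /\ 0 < q).
  by rewrite extend2E// A0.
by rewrite extend2_out.
Qed.

Lemma extend2_le A (A0 : R) : 0 <= A0 -> (forall p q, 0 < p -> 0 < q ->
     A p q <= A0 * (1 + p) `^ 2^-1 * (1 + q) `^ 2^-1) ->
  forall p q, extend2 A p q <= A0 * (sw p * sw q).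
Proof.
move=> A00 AA p q; have [[p0 q0]|npq] := pselect (0 < p /\ 0 < q).
  rewrite extend2E//; apply: (le_trans (AA _ _ p0 q0)).
  have p1 : 0 <= 1 + p by rewrite addr_ge0 ?ltW.
  have q1 : 0 <= 1 + q by rewrite addr_ge0 ?ltW.
  by rewrite !powR12_sqrt// /sw /wt !gtr0_norm// mulrA.
by rewrite extend2_out// !mulr_ge0 ?sw_ge0.
Qed.

Definition extend1 Rm : R -> R := Rm \_ (Rpos R).

Lemma extend1E Rm p : 0 < p -> extend1 Rm p = Rm p.
Proof. by move=> p0; rewrite /extend1 patchE mem_set. Qed.

Lemma extend1_out Rm p : ~ Rpos R p -> extend1 Rm p = 0.
Proof. by move=> np; rewrite /extend1 patchE memNset. Qed.

Lemma extend1_meas Rm :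
  measurable_fun (Rpos R) Rm -> measurable_fun setT (extend1 Rm).
Proof. exact: (measurable_restrictT _ measurable_Rpos).1. Qed.

Lemma extend1_ge0 Rm : (forall p, 0 < p -> 0 <= Rm p) -> forall p, 0 <= extend1 Rm p.
Proof.
move=> R0 p; have [p0|np] := pselect (0 < p); first by rewrite extend1E// R0.
by rewrite extend1_out.
Qed.

Lemma extend1_sub Rm (k alpha : R) : 0 <= k -> 0 <= alpha < 1 ->
  (forall p, 0 < p -> Rm p <= k * (1 + p) `^ alpha) ->
  forall e, 0 < e -> exists2 K, 0 <= K & forall p, extend1 Rm p <= K + e * wt p.
Proof.
move=> k0 al H e e0; have [K K0 HK] := powR_sublinear k0 al e0.
exists K => // p; have [p0|np] := pselect (0 < p); last first.
  by rewrite extend1_out// addr_ge0// mulr_ge0 ?wt_ge0// ltW.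
rewrite extend1E// (le_trans (H _ p0))// /wt gtr0_norm//.
by apply: HK; rewrite lerDl ltW.
Qed.

End Coefs.

Section Equation.
Context {R : realType}.
Notation mu := (@lebesgue_measure R).
Notation mu2 := (product_measure1 mu mu).
Variables (zin S Rm : R -> R) (A : R -> R -> R) (k alpha A0 : R).
Hypotheses (zin_L1 : in_L1_01 zin)
  (S_L1 : in_L1_01 S)
  (k_ge0 : 0 <= k) (alpha_bnd : 0 <= alpha < 1)
  (Rm_meas : measurable_fun (Rpos R) Rm)
  (Rm_ge0 : forall p : R, 0 < p -> 0 <= Rm p)
  (Rm_bnd : forall p : R, 0 < p -> Rm p <= k * (1 + p) `^ alpha)
  (A_meas : measurable_fun (Rpos R `*` Rpos R) (fun pq : R * R => A pq.1 pq.2))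
  (A_ge0 : forall p q : R, 0 < p -> 0 < q -> 0 <= A p q)
  (A0_ge0 : 0 <= A0)
  (A_bnd : forall p q : R, 0 < p -> 0 < q ->
     A p q <= A0 * (1 + p) `^ 2^-1 * (1 + q) `^ 2^-1).

Let A' := extend2 A.
Let R' := extend1 Rm.
Let mA' := extend2_meas A_meas.
Let A'_ge0 := extend2_ge0 A_ge0.
Let A'_le := extend2_le A0_ge0 A_bnd.
Let mR' := extend1_meas Rm_meas.
Let R'_ge0 := extend1_ge0 Rm_ge0.
Let R'_sub := extend1_sub k_ge0 alpha_bnd Rm_bnd.
Let rateR := net_rate A' R'.

Variable zeta : R -> R -> R.
Hypothesis zeta_sol : weak_solution A S Rm zin zeta.
Variables (T M : R).
Hypothesis admZ : forall r, 0 <= r < T -> admissible M (clean zeta r).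

Let zeta_ge0 : forall t : R, 0 <= t -> ae_ge0 (zeta t).
Proof. by case: zeta_sol. Qed.
Let zeta_cont : in_C_weak_L1 zeta.
Proof. by case: zeta_sol. Qed.

Let Z := clean_density zeta_cont.

Section fixed_time.
Variables (s m : R) (w : R -> R).
Hypotheses (s0 : 0 <= s) (admS : admissible M (clean zeta s))
  (bw : bounded_meas m w).

Let K p q := omega_tilde w p q * A' p q.
Let h p := \int[mu]_q (K p q * clean zeta s q).

Let mK : measurable_fun setT (fun z : R * R => K z.1 z.2).
Proof.
by apply: measurable_funM => //; apply: measurable_omega_tilde; case: bw.
Qed.

Let mKp p : measurable_fun setT (K p).
Proof. exact: (measurableT_comp mK (measurable_pair1 p)). Qed.

Let mz : measurable_fun setT (clean zeta s).
Proof. by case: admS. Qed.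

Let mh : measurable_fun setT h.
Proof.
have mZ E : measurable E ->
    measurable_fun setT (fun x : R => \int[mu]_(y in E) (Z s y)%:E)%E by [].
exact: (measurable_Rintegral_density mZ mK).
Qed.

Let inner_intg p : integrableT (fun q => K p q * clean zeta s q).
Proof.
have m0 := bounded_meas_ge0 bw; have [_ z0 zi _] := admS.
apply: (integrableT_le _ (integrableTZ (3 * m * A0 * sw p) zi)).
  exact: measurable_funM.
move=> q; rewrite !normrM (ger0_norm (A'_ge0 _ _)) (ger0_norm (z0 q)).
rewrite mulrA ler_wpM2r//.
have -> : 3 * m * A0 * sw p * wt q = 3 * m * (A0 * (sw p * wt q)) by ring.
apply: ler_pM => //; first exact: omega_tilde_le.
apply: (le_trans (A'_le _ _)); rewrite ler_wpM2l// ler_wpM2l ?sw_ge0//.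
exact: sw_le_wt.
Qed.

Let inner_eq p : 0 < p ->
  (\int[mu]_(q in Rpos R) (omega_tilde w p q * A p q * zeta s p * zeta s q)%:E
   = (h p * zeta s p)%:E)%E.
Proof.
move=> p0.
rewrite (@integral_Rpos_ext _ _ (fun q => K p q * clean zeta s q * zeta s p)).
- by rewrite (RintegralZr _ measurableT (inner_intg p)).
- have mf : measurable_fun (Rpos R) (fun q => K p q * zeta s p * zeta s q).
    apply: measurable_funM; last exact: zeta_meas.
    by apply: measurable_funTS; apply: measurable_funM.
  apply: eq_measurable_fun mf => q; rewrite inE => q0.
  by rewrite /K /A' extend2E.
- rewrite (_ : (fun q => _) = (fun q => zeta s p * (K p q * clean zeta s q))).
    exact: integrableTZ.
  by apply/funext => q; rewrite mulrC.
- by move=> q nq; rewrite clean_out// mulr0 mul0r.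
- apply: ae_imp (clean_ae zeta_ge0 s0) => q E q0.
  by rewrite E// /K /A' extend2E//; ring.
Qed.

Let F2i : integrableT2 (fun z => omega_tilde w z.1 z.2 * A' z.1 z.2 *
  clean zeta s z.1 * clean zeta s z.2).
Proof.
have [_ z0 zi _] := admS.
exact: (integrableT2_coag mA' A'_ge0 A0_ge0 A'_le bw mz mz zi zi).
Qed.

Let fiber_eq p : (\int[mu]_q (omega_tilde w p q * A' p q *
    clean zeta s p * clean zeta s q)%:E = (h p * clean zeta s p)%:E)%E.
Proof.
rewrite /h -(RintegralZr _ measurableT (inner_intg p)) EFin_Rintegral.
  by apply: eq_integral => q _; congr EFin; rewrite /K; ring.
rewrite (_ : (fun q => _) = (fun q => clean zeta s p * (K p q * clean zeta s q))).
  exact: integrableTZ.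
by apply/funext => q; rewrite mulrC.
Qed.

Let coag_iter : ((coag_rate A' w (clean zeta s))%:E =
  \int[mu]_p (h p * clean zeta s p)%:E)%E.
Proof.
rewrite /coag_rate /Rintegral fineK; last exact: integrable_fin_num F2i.
rewrite -(integral12_prod_meas1 F2i).
by apply: eq_integral => p _; rewrite /fubini_F /= fiber_eq.
Qed.

Let outer_intg : integrableT (fun p => h p * clean zeta s p).
Proof.
apply: eq_integrable (integrable_fubini_F F2i) => // p _.
by rewrite /fubini_F /= fiber_eq.
Qed.

(** zeta s differs from its clean representative on a null set only, so it is
    replaced in the inner variable first and in the outer one afterwards. The
    function h makes the intermediate outer integrand visibly measurable. *)
Lemma coag_integral : (\int[mu]_(p in Rpos R) \int[mu]_(q in Rpos R)
    (omega_tilde w p q * A p q * zeta s p * zeta s q)%:E =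
  (coag_rate A' w (clean zeta s))%:E)%E.
Proof.
transitivity (\int[mu]_(p in Rpos R) (h p * zeta s p)%:E)%E.
  by apply: eq_integral => p; rewrite inE => p0; rewrite inner_eq.
rewrite coag_iter (@integral_Rpos_ext _ _ (fun p => h p * clean zeta s p)).
- by rewrite EFin_Rintegral//; exact: outer_intg.
- apply: measurable_funM; last exact: zeta_meas.
  exact: measurable_funTS.
- exact: outer_intg.
- by move=> p np; rewrite clean_out ?mulr0.
- by apply: ae_imp (clean_ae zeta_ge0 s0) => p E p0; rewrite E.
Qed.

Let wSi : integrableT (fun p => w p * extend1 S p).
Proof.
by apply: (integrableT_bM bw); apply/integrableT_restrict; exact: in_L1_of_01.
Qed.

Let wRi : integrableT (fun p => w p * (R' p * clean zeta s p)).
Proof.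
have [_ _ zi _] := admS.
exact: (integrableT_bM bw (integrableT_dom mz mR' R'_ge0 (Rm_le_wt R'_sub) zi)).
Qed.

Lemma linear_integral :
  (\int[mu]_(p in Rpos R) (w p * (S p - Rm p * zeta s p))%:E =
  (\int[mu]_p (w p * extend1 S p) - \int[mu]_p (w p * (R' p * clean zeta s p)))%:E)%E.
Proof.
rewrite -RintegralB//.
apply: integral_Rpos_ext.
- apply: measurable_funM; first by apply: measurable_funTS; case: bw.
  apply: measurable_funB.
    by apply/measurable_EFinP; exact: (measurable_int _ (in_L1_of_01 S_L1)).
  by apply: measurable_funM => //; exact: zeta_meas.
- exact: integrableTB.
- by move=> p np; rewrite !extend1_out// /R' extend1_out//; ring.
- apply: ae_imp (clean_ae zeta_ge0 s0) => p E p0.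
  by rewrite E// /R' !extend1E//; ring.
Qed.

Lemma increment_integral :
  (\int[mu]_(p in Rpos R) ((zeta s p - zin p) * w p)%:E =
  (\int[mu]_p (w p * clean zeta s p) - \int[mu]_p (w p * extend1 zin p))%:E)%E.
Proof.
have i1 := integrableT_bM bw (clean_intg zeta_cont s).
have i2 : integrableT (fun p => w p * extend1 zin p).
  by apply: (integrableT_bM bw); apply/integrableT_restrict; exact: in_L1_of_01.
rewrite -RintegralB//.
apply: integral_Rpos_ext.
- apply: measurable_funM; last by apply: measurable_funTS; case: bw.
  apply: measurable_funB; first exact: zeta_meas.
  by apply/measurable_EFinP; exact: (measurable_int _ (in_L1_of_01 zin_L1)).
- exact: integrableTB.
- by move=> p np; rewrite extend1_out// clean_out//; ring.
- apply: ae_imp (clean_ae zeta_ge0 s0) => p E p0.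
  by rewrite E// extend1E//; ring.
Qed.

End fixed_time.
Section time.
Variables (m : R) (w : R -> R).
Hypothesis bw : bounded_meas m w.

Let tm := clean_time_measurable zeta_ge0 zeta_cont.

Let coag_meas : measurable_fun setT (fun r => coag_rate A' w (clean zeta r)).
Proof.
have mH : measurable_fun setT (fun z : R * R => omega_tilde w z.1 z.2 * A' z.1 z.2).
  by apply: measurable_funM => //; apply: measurable_omega_tilde; case: bw.
exact: (measurable_Rintegral2_density tm mH).
Qed.

Let removal_meas :
  measurable_fun setT (fun r => \int[mu]_p (w p * (R' p * clean zeta r p))).
Proof.
have mk : measurable_fun setT (fun z : R * R => w z.2 * R' z.2).
  by apply: measurable_funM; apply: measurableT_comp => //; case: bw.
have := measurable_Rintegral_density tm mk.
congr measurable_fun; apply/funext => r; congr Rintegral; apply/funext => p.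
by rewrite /= mulrA.
Qed.

Let integrableT_time t (f : R -> R) : measurable_fun setT f ->
  (exists C, forall r, 0 <= r <= t -> `|f r| <= C) ->
  mu.-integrable `[0, t] (EFin \o f).
Proof.
move=> mf [C fC]; apply: measurable_bounded_integrable => //.
- by rewrite /= lebesgue_measure_itv/=; case: ifP => //; rewrite -EFinB ltry.
- exact: measurable_funTS.
- exists C; split; first exact: num_real.
  move=> x Cx r /=; rewrite in_itv/= => rt.
  by rewrite (le_trans (fC r rt))// ltW.
Qed.

Let coag_time t : t < T ->
  mu.-integrable `[0, t] (EFin \o (fun r => coag_rate A' w (clean zeta r))).
Proof.
move=> tT; apply: integrableT_time => //.
have [C HC] := coag_bounded mA' A'_ge0 A0_ge0 A'_le m M.
exists C => r /andP[r0 rt]; apply: HC => //; apply: admZ.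
by rewrite r0 (le_lt_trans rt).
Qed.

Let removal_time t (c : R) : t < T ->
  mu.-integrable `[0, t]
    (EFin \o (fun r => c - \int[mu]_p (w p * (R' p * clean zeta r p)))).
Proof.
move=> tT; apply: integrableT_time.
  by apply: measurable_funB.
have [C HC] := removal_bounded mR' R'_ge0 R'_sub m M.
exists (`|c| + C) => r /andP[r0 rt]; rewrite (le_trans (ler_normB _ _))// lerD2l.
apply: HC => //; apply: admZ.
by rewrite r0 (le_lt_trans rt).
Qed.

Lemma rate_timec t c : t < T ->
  mu.-integrable `[0, t] (EFin \o (fun r => rateR w (clean zeta r) + c)).
Proof.
move=> tT.
apply: (@eq_integrable _ _ _ mu _ _
  ((fun r => 2^-1%:E * (coag_rate A' w (clean zeta r))%:E)
  \+ (EFin \o (fun r => c - \int[mu]_p (w p * (R' p * clean zeta r p)))%R))%E) => //.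
  by move=> r _; rewrite /= -EFinM -EFinD /rateR /net_rate; congr EFin; ring.
apply: integrableD => //; last exact: removal_time.
by apply: integrableZl => //; exact: coag_time.
Qed.

Lemma rate_time t : t < T ->
  mu.-integrable `[0, t] (EFin \o (fun r => rateR w (clean zeta r))).
Proof.
move=> tT.
apply: (@eq_integrable _ _ _ mu _ _
  (EFin \o (fun r => rateR w (clean zeta r) + 0))) => //.
  by move=> r _; rewrite /= addr0.
exact: rate_timec.
Qed.

(** At each time before T all inner integrals are finite, so the equation between
    extended reals becomes one between real numbers. *)
Lemma pairing_eq t : 0 <= t < T ->
  \int[mu]_p (w p * clean zeta t p) - \int[mu]_p (w p * extend1 zin p) =
  \int[mu]_(r in `[0, t]) (rateR w (clean zeta r) + \int[mu]_p (w p * extend1 S p)).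
Proof.
move=> /andP[t0 tT]; set c := \int[mu]_p (w p * extend1 S p).
have [_ _ _ eqn] := zeta_sol.
have t1 : 0 < t + 1 by rewrite ltr_wpDl.
have tt : 0 <= t <= t + 1 by rewrite t0/= lerDl.
have := eqn _ t1 _ tt _ (bounded_meas_Linfty bw).
rewrite (increment_integral t0 bw).
rewrite [X in (2^-1%:E * X)%E](_ : _ =
    \int[mu]_(r in `[0%R, t]) (coag_rate A' w (clean zeta r))%:E)%E; last first.
  apply: eq_integral => r; rewrite inE/= in_itv/= => /andP[r0 rt].
  apply: (coag_integral r0 _ bw); apply: admZ.
  by rewrite r0 (le_lt_trans rt).
rewrite [X in (_ + X)%E](_ : _ = \int[mu]_(r in `[0%R, t])
    (c - \int[mu]_p (w p * (R' p * clean zeta r p)))%:E)%E; last first.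
  apply: eq_integral => r; rewrite inE/= in_itv/= => /andP[r0 rt].
  apply: (linear_integral r0 _ bw); apply: admZ.
  by rewrite r0 (le_lt_trans rt).
have mI : measurable (`[0, t]%classic : set R) by [].
rewrite -integralZl//; last exact: coag_time.
rewrite -integralD//; last exact: (removal_time c tT).
  move=> E; apply: EFin_inj; rewrite E /Rintegral fineK; last first.
    by apply: integrable_fin_num => //; exact: rate_timec.
  apply: eq_integral => r _; rewrite -EFinM -EFinD; congr EFin.
  by rewrite /rateR /net_rate /Rintegral; ring.
exact: (integrableZl _ _ (coag_time tT)).
Qed.

End time.
End Equation.

(** * Uniqueness of weak solutions *)

Lemma admissible_le (R : realType) (M M' : R) f :
  M <= M' -> admissible M f -> admissible M' f.
Proof. by move=> MM [h1 h2 h3 h4]; split=> //; exact: le_trans MM. Qed.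

Lemma clean_admissible_ex (R : realType) (A : R -> R -> R) (S Rm zin : R -> R)
    (zeta : R -> R -> R) (T : R) : weak_solution A S Rm zin zeta -> 0 < T ->
  exists M, forall r, 0 <= r < T -> admissible M (clean zeta r).
Proof.
move=> [ge0 cont bound _] T0; have [M HM] := bound T T0.
by exists M => r rT; exact: (clean_admissible ge0 cont HM).
Qed.

Section Difference.
Context {R : realType}.
Notation mu := (@lebesgue_measure R).
Variables (zin S Rm : R -> R) (A : R -> R -> R) (k alpha A0 : R).
Hypotheses (zin_L1 : in_L1_01 zin)
  (S_L1 : in_L1_01 S)
  (k_ge0 : 0 <= k) (alpha_bnd : 0 <= alpha < 1)
  (Rm_meas : measurable_fun (Rpos R) Rm)
  (Rm_ge0 : forall p : R, 0 < p -> 0 <= Rm p)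
  (Rm_bnd : forall p : R, 0 < p -> Rm p <= k * (1 + p) `^ alpha)
  (A_meas : measurable_fun (Rpos R `*` Rpos R) (fun pq : R * R => A pq.1 pq.2))
  (A_ge0 : forall p q : R, 0 < p -> 0 < q -> 0 <= A p q)
  (A0_ge0 : 0 <= A0)
  (A_bnd : forall p q : R, 0 < p -> 0 < q ->
     A p q <= A0 * (1 + p) `^ 2^-1 * (1 + q) `^ 2^-1).
Variables (zeta xi : R -> R -> R).
Hypothesis zeta_sol : weak_solution A S Rm zin zeta.
Hypothesis xi_sol : weak_solution A S Rm zin xi.
Variables (T M : R).
Hypothesis admZ : forall r, 0 <= r < T -> admissible M (clean zeta r).
Hypothesis admX : forall r, 0 <= r < T -> admissible M (clean xi r).

Let rateR := net_rate (extend2 A) (extend1 Rm).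
Let D w r := rateR w (clean xi r) - rateR w (clean zeta r).

Let D_time m w t : bounded_meas m w -> t < T -> mu.-integrable `[0, t] (EFin \o D w).
Proof.
move=> bw tT.
have h1 := rate_time k_ge0 alpha_bnd Rm_meas Rm_ge0 Rm_bnd A_meas A_ge0 A0_ge0
  A_bnd xi_sol admX bw tT.
have h2 := rate_time k_ge0 alpha_bnd Rm_meas Rm_ge0 Rm_bnd A_meas A_ge0 A0_ge0
  A_bnd zeta_sol admZ bw tT.
exact: (integrableB _ h1 h2).
Qed.

(** Initial value and source cancel in the difference of the two equations. *)
Lemma difference_eq m w t : bounded_meas m w -> 0 <= t < T ->
  \int[mu]_p (w p * (clean xi t p - clean zeta t p)) =
  \int[mu]_(r in `[0, t]) D w r.
Proof.
move=> bw tT; have /andP[t0 tT'] := tT.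
have h1 c := rate_timec k_ge0 alpha_bnd Rm_meas Rm_ge0 Rm_bnd A_meas A_ge0 A0_ge0
  A_bnd xi_sol admX bw c tT'.
have h2 c := rate_timec k_ge0 alpha_bnd Rm_meas Rm_ge0 Rm_bnd A_meas A_ge0 A0_ge0
  A_bnd zeta_sol admZ bw c tT'.
have e1 := pairing_eq zin_L1 S_L1 k_ge0 alpha_bnd Rm_meas Rm_ge0 Rm_bnd A_meas
  A_ge0 A0_ge0 A_bnd xi_sol admX bw tT.
have e2 := pairing_eq zin_L1 S_L1 k_ge0 alpha_bnd Rm_meas Rm_ge0 Rm_bnd A_meas
  A_ge0 A0_ge0 A_bnd zeta_sol admZ bw tT.
have [_ xcont _ _] := xi_sol; have [_ zcont _ _] := zeta_sol.
have ix := integrableT_bM bw (clean_intg xcont t).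
have iz := integrableT_bM bw (clean_intg zcont t).
transitivity (\int[mu]_p (w p * clean xi t p) - \int[mu]_p (w p * clean zeta t p)).
  rewrite -RintegralB//; congr Rintegral; apply/funext => p.
  by rewrite mulrBr.
transitivity (\int[mu]_(r in `[0, t])
      (rateR w (clean xi r) + \int[mu]_p (w p * extend1 S p)) -
    \int[mu]_(r in `[0, t])
      (rateR w (clean zeta r) + \int[mu]_p (w p * extend1 S p))).
  by rewrite -e1 -e2; ring.
rewrite -RintegralB//.
by congr Rintegral; apply/funext => r; rewrite /D; ring.
Qed.

(** The increment is the integral over ]s, t] of the difference of the rates. *)
Lemma difference_mean_value m w s t K :
  bounded_meas m w -> 0 <= s -> s <= t -> t < T ->
  (forall r, s <= r <= t -> rateR w (clean xi r) - rateR w (clean zeta r) <= K) ->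
  \int[mu]_p (w p * (clean xi t p - clean zeta t p)) -
  \int[mu]_p (w p * (clean xi s p - clean zeta s p)) <= K * (t - s).
Proof.
move=> bw s0 st tT DK.
have tT' : 0 <= t < T by rewrite tT (le_trans s0).
have sT' : 0 <= s < T by rewrite s0 (le_lt_trans st).
rewrite (difference_eq bw tT') (difference_eq bw sT').
rewrite Rintegral_itvB ?bnd_simp//; last exact: D_time bw tT.
have st_ge0 : 0 <= t - s by rewrite subr_ge0.
have Di : mu.-integrable `]s, t] (EFin \o D w).
  apply: integrableS (D_time bw tT) => //.
  by move=> r /=; rewrite !in_itv/= => /andP[sr ->]; rewrite (le_trans s0) ?ltW.
have Ki : mu.-integrable `]s, t] (EFin \o (fun=> K)).
  apply: measurable_bounded_integrable => //.
  - by rewrite /= lebesgue_measure_itv/=; case: ifP => //; rewrite -EFinB ltry.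
  - exists `|K|; split; first exact: num_real.
    by move=> x Kx r _; exact: ltW.
apply: (@le_trans _ _ (\int[mu]_(r in `]s, t]) K)).
  apply: le_Rintegral => // r /=; rewrite in_itv/= => /andP[sr rt].
  by apply: DK; rewrite (ltW sr).
rewrite Rintegral_cst//= lebesgue_measure_itv/= lte_fin.
have [st'|ts] := ltP s t; first by [].
have -> : t = s by apply/eqP; rewrite eq_le st ts.
by rewrite subrr.
Qed.

(** At time 0 the time integral is over a point; test with the sign of u 0. *)
Lemma difference_0 : 0 < T -> \int[mu]_p `|clean xi 0 p - clean zeta 0 p| = 0.
Proof.
move=> T0; have T0' : 0 <= (0 : R) < T by rewrite lexx.
have [_ xcont _ _] := xi_sol; have [_ zcont _ _] := zeta_sol.
pose w p := Num.sg (clean xi 0 p - clean zeta 0 p).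
have bw : bounded_meas 1 w.
  split; first by apply: measurable_sg; apply: measurable_funB; exact: clean_meas.
  by move=> p; rewrite normr_sg; case: (_ != 0); rewrite /= ?ler01.
have := difference_eq bw T0'; rewrite set_itv1 Rintegral_set1 => w0; rewrite -[RHS]w0.
by congr Rintegral; apply/funext => p; rewrite /w -normrEsg.
Qed.

End Difference.

Theorem theorem2p2 (R : realType)
  (zin S Rm : R -> R) (A : R -> R -> R) (k alpha A0 : R)
  (zin_L1 : in_L1_01 zin) (zin_ge0 : ae_ge0 zin)
  (S_L1 : in_L1_01 S) (S_ge0 : ae_ge0 S)
  (k_ge0 : 0 <= k) (alpha_bnd : 0 <= alpha < 1)
  (Rm_meas : measurable_fun (Rpos R) Rm)
  (Rm_ge0 : forall p : R, 0 < p -> 0 <= Rm p)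
  (Rm_bnd : forall p : R, 0 < p -> Rm p <= k * (1 + p) `^ alpha)
  (A_meas : measurable_fun (Rpos R `*` Rpos R) (fun pq : R * R => A pq.1 pq.2))
  (A_ge0 : forall p q : R, 0 < p -> 0 < q -> 0 <= A p q)
  (A_sym : forall p q : R, 0 < p -> 0 < q -> A p q = A q p)
  (A0_ge0 : 0 <= A0)
  (A_bnd : forall p q : R, 0 < p -> 0 < q ->
     A p q <= A0 * (1 + p) `^ 2^-1 * (1 + q) `^ 2^-1)
  (zeta : R -> R -> R) (zeta_sol : weak_solution A S Rm zin zeta) :
  forall xi : R -> R -> R, weak_solution A S Rm zin xi ->
  forall t : R, 0 <= t ->
  {ae @lebesgue_measure R, forall p : R, 0 < p -> xi t p = zeta t p}.
Proof.
move=> xi xi_sol t t0.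
have T0 : 0 < t + 1 by rewrite ltr_wpDl.
have [Mz adz] := clean_admissible_ex zeta_sol T0.
have [Mx adx] := clean_admissible_ex xi_sol T0.
pose M := Num.max Mz Mx.
have admZ r : 0 <= r < t + 1 -> admissible M (clean zeta r).
  by move=> rT; apply: (admissible_le _ (adz r rT)); rewrite le_max lexx.
have admX r : 0 <= r < t + 1 -> admissible M (clean xi r).
  by move=> rT; apply: (admissible_le _ (adx r rT)); rewrite le_max lexx orbT.
have tT : 0 <= t < t + 1 by rewrite t0 ltrDl/=.
have eq0 := uniqueness_of_mean_value (extend2_meas A_meas) (extend2_ge0 A_ge0) A0_ge0
  (extend2_le A0_ge0 A_bnd) (extend1_meas Rm_meas) (extend1_ge0 Rm_ge0)
  (extend1_sub k_ge0 alpha_bnd Rm_bnd) admX admZ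
  (difference_mean_value zin_L1 S_L1 k_ge0 alpha_bnd Rm_meas Rm_ge0 Rm_bnd A_meas A_ge0
    A0_ge0 A_bnd zeta_sol xi_sol admZ admX)
  (difference_0 zin_L1 S_L1 k_ge0 alpha_bnd Rm_meas Rm_ge0 Rm_bnd A_meas A_ge0
    A0_ge0 A_bnd zeta_sol xi_sol admZ admX T0) tT.
have [xge0 xcont _ _] := xi_sol; have [zge0 zcont _ _] := zeta_sol.
have di := integrableTB (clean_intg xcont t) (clean_intg zcont t).
have : (\int[@lebesgue_measure R]_p `|(clean xi t p - clean zeta t p)%:E| = 0)%E.
  by rewrite -(EFin_Rintegral (integrableT_norm di)) eq0.
move=> /(ae_eq_integral_abs _ measurableT (measurable_int _ di)).1 d0.
apply: ae_imp (ae_and (ae_and (clean_ae xge0 t0) (clean_ae zge0 t0)) d0).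
move=> p [[hx hz] d] p0.
rewrite hx// hz//; apply/eqP; rewrite -subr_eq0; apply/eqP.
by case: (d I).
Qed.
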